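(* Consider a two-color balanced affine tenable urn model with sample size $m\ge1$, under either sampling model $\mathcal M$ or $\mathcal R$. Let $\tilde W_n=W_n-\frac{a_m}{1-\Lambda}n$ (so $\tilde W_n=W_n$ if $a_m=0$), let $E_s=\lim_{n\to\infty}\mathbb E\big[\tilde W_n^s/n^{s\Lambda}\big]$ for integers $s\ge1$, and $E_0=1$. (i) For large-index urns ($a_m\ne0$, $\frac12<\Lambda<1$), all positive integer moments of $\mathcal W_\infty$ exist, and for every integer $s\ge1$ $$\mathbb E[\mathcal W_\infty^s]=\sum_{k=0}^{s}\binom sk\frac{\Gamma^k(\frac{T_0}{\sigma}+\Lambda)}{\Gamma^k(\frac{T_0}{\sigma})}\,E_k\,\Big(\frac{a_mT_0}{\sigma(1-\Lambda)}-W_0\Big)^{s-k}.$$ (ii) For triangular urns ($a_m=0$, $a_{m-1}>0$, $\sigma\ge m a_{m-1}$), all positive integer moments of $\mathfrak W_\infty$ exist, and for every integer $s\ge1$ $$\mathbb E[\mathfrak W_\infty^s]=\frac{\Gamma^s(\frac{T_0}{\sigma}+\Lambda)}{\Gamma^s(\frac{T_0}{\sigma})}\,E_s.$$ Here $\mathcal W_\infty$ and $\mathfrak W_\infty$ are the almost-sure limits defined in the context, and $\Gamma^k(x)$ means $(\Gamma(x))^k$.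
   Context: Urn model. Fix integers $m\ge1$ and $\sigma\ge1$. An urn contains white and black balls; $W_n$ and $B_n$ denote their numbers after $n$ draws ($W_0,B_0$ nonrandom), and $T_n=W_n+B_n$. At each step a sample of $m$ balls is drawn, its colors are observed, and the sample is returned to the urn; if the sample has $k$ white and $m-k$ black balls, then $a_{m-k}$ white and $b_{m-k}$ black balls are added (negative numbers mean removal), $0\le k\le m$, where $a_k,b_k$ are integers. Standing assumptions: balanced, $a_k+b_k=\sigma$ for all $0\le k\le m$, so $T_n=T_0+\sigma n$; affine, $a_k=(m-k)(a_{m-1}-a_m)+a_m$ for $0\le k\le m$; tenable, i.e. the process can be continued forever (in particular $W_n,B_n\ge0$ always; for model $\mathcal M$ one has $a_k\ge-(m-k)$ for $0\le k\le m$; for model $\mathcal R$ one has $a_k\ge -1$ for $0\le k\le m-1$ and $a_m\ge0$); and $T_0\ge m$. Sampling. Given the first $n-1$ draws, the probability that the $n$th sample has exactly $k$ white balls is $\binom{W_{n-1}}{k}\binom{B_{n-1}}{m-k}/\binom{T_{n-1}}{m}$ in model $\mathcal M$ (without replacement) and $\binom mk W_{n-1}^kB_{n-1}^{m-k}/T_{n-1}^m$ in model $\mathcal R$ (with replacement). Urn index: $\Lambda=\frac{m}{\sigma}(a_{m-1}-a_m)$. Convention: if $a_m=0$, then $\frac{a_m}{1-\Lambda}$ is read as $0$, even if $\Lambda=1$. The limits $E_s$ exist for large-index and for triangular urns. Martingale limits. Let $g_n=\prod_{j=0}^{n-1}\frac{T_j}{T_j+m(a_{m-1}-a_m)}$.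 For large-index urns, $\mathcal W_n=g_n(W_n-\mathbb E[W_n])$ is a martingale for the natural filtration converging almost surely (and in $L_2$) to a limit $\mathcal W_\infty$. For triangular urns, $\mathfrak W_n=g_nW_n$ is a nonnegative martingale converging almost surely to a limit $\mathfrak W_\infty$. *)

(* Defs.v *)
From HB Require Import structures.
From mathcomp Require Import all_boot all_order all_algebra.
From mathcomp Require Import all_classical all_reals all_analysis.

Set Implicit Arguments.
Unset Strict Implicit.
Unset Printing Implicit Defensive.

Import Order.TTheory GRing.Theory Num.Theory.
Import numFieldNormedType.Exports.

Local Open Scope classical_set_scope.
Local Open Scope ring_scope.

Definition Gamma (R : realType) (x : R) : R :=
  \int[lebesgue_measure]_(t in `]0, +oo[) (t `^ (x - 1) * expR (- t)).

(* model M is sampling without replacement, model R is with replacement *)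
Inductive sampling := ModelM | ModelR.

(* [whiteadd k] and [blackadd k] are the numbers a_k and b_k of balls added when
   the sample contains k BLACK balls; only the values for k <= ssize matter. *)
Record urn := Urn {
  ssize : nat;
  balance : nat;
  whiteadd : nat -> int;
  blackadd : nat -> int;
  white0 : nat;
  black0 : nat }.

Section Urn.
Variable u : urn.

Local Notation m := (ssize u).
Local Notation sigma := (balance u).
Local Notation a := (whiteadd u).
Local Notation b := (blackadd u).

Definition total0 : nat := (white0 u + black0 u)%N.
Definition total_balls (n : nat) : nat := (total0 + sigma * n)%N.

(* Composition after n draws along the history [h], where [h i] is the number of
   white balls in the (i+1)-st sample. *)
Definition white (h : nat -> nat) (n : nat) : int :=
  (white0 u)%:Z + \sum_(i < n) a (m - h i)%N.
Definition black (h : nat -> nat) (n : nat) : int :=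
  (black0 u)%:Z + \sum_(i < n) b (m - h i)%N.

Definition balanced : Prop :=
  forall k : nat, (k <= m)%N -> a k + b k = sigma%:Z.

Definition affine : Prop :=
  forall k : nat, (k <= m)%N -> a k = (m - k)%N%:Z * (a m.-1 - a m) + a m.

(* Favourable outcomes for a sample with k white balls, and all outcomes, in an
   urn with w white and c black balls. *)
Definition favourable (M : sampling) (w c k : nat) : nat :=
  match M with
  | ModelM => 'C(w, k) * 'C(c, m - k)
  | ModelR => 'C(m, k) * w ^ k * c ^ (m - k)
  end.
Definition outcomes (M : sampling) (w c : nat) : nat :=
  match M with
  | ModelM => 'C(w + c, m)
  | ModelR => (w + c) ^ m
  end.

(* The histories whose first n draws have positive probability.  The absolute
   values only convert int to nat: for a tenable urn, the compositions met here
   are nonnegative. *)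
Definition feasible (M : sampling) (h : nat -> nat) (n : nat) : Prop :=
  forall i : nat, (i < n)%N ->
    (h i <= m)%N /\ (0 < favourable M `|white h i| `|black h i| (h i))%N.

Definition tenable (M : sampling) : Prop :=
  (forall (h : nat -> nat) (n : nat), feasible M h n ->
     0 <= white h n /\ 0 <= black h n) /\
  match M with
  | ModelM => forall k : nat, (k <= m)%N -> - (m - k)%N%:Z <= a k
  | ModelR => (forall k : nat, (k < m)%N -> -1 <= a k) /\ 0 <= a m
  end.

Definition urn_assumptions (M : sampling) : Prop :=
  [/\ (1 <= m)%N, (1 <= sigma)%N & (m <= total0)%N] /\
  [/\ balanced, affine & tenable M].

Section Real.
Variable R : realType.

Definition draw_prob (M : sampling) (w c : int) (k : nat) : R :=
  (favourable M `|w| `|c| k)%:R / (outcomes M `|w| `|c|)%:R.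

Definition Lambda : R := m%:R / sigma%:R * (a m.-1 - a m)%:~R.

(* As 0 / x = 0 for all x, this is 0 when a_m = 0, even if Lambda = 1. *)
Definition drift : R := (a m)%:~R / (1 - Lambda).

Definition large_index : Prop :=
  a m <> 0 /\ 1 / 2 < Lambda < 1.

Definition triangular : Prop :=
  [/\ a m = 0, 0 < a m.-1 & m%:Z * a m.-1 <= sigma%:Z].

Definition g (n : nat) : R :=
  \prod_(j < n) ((total_balls j)%:R / ((total_balls j)%:R + m%:R * (a m.-1 - a m)%:~R)).

Section Process.
Context {d : measure_display} {T : measurableType d} {P : probability T R}.
(* [K n] is the number of white balls in the (n+1)-st sample. *)
Variable K : nat -> {RV P >-> nat}.

(* The conditional law of each draw given the previous ones, written in product
   form so that null histories need no special treatment. *)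
Definition urn_process (M : sampling) : Prop :=
  (forall (n : nat) (w : T), (K n w <= m)%N) /\
  forall (h : nat -> nat) (n : nat), (forall i : nat, (i <= n)%N -> (h i <= m)%N) ->
    P [set w | forall i : nat, (i <= n)%N -> K i w = h i] =
    (P [set w | forall i : nat, (i < n)%N -> K i w = h i] *
     (draw_prob M (white h n) (black h n) (h n))%:E)%E.

Definition W (n : nat) (w : T) : R := (white (fun i => K i w) n)%:~R.

Definition Wtilde (n : nat) (w : T) : R := W n w - drift * n%:R.

Definition limit_moment (s : nat) : R :=
  if s is 0%N then 1 else
  limn (fun n : nat =>
    fine 'E_P[(fun w => (Wtilde n w ^+ s / n%:R `^ (s%:R * Lambda))%R)]).

Definition centered_martingale (n : nat) (w : T) : R :=
  g n * (W n w - fine 'E_P[W n]).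

Definition triangular_martingale (n : nat) (w : T) : R := g n * W n w.

End Process.
End Real.
End Urn.

(* Main.v *)
Require Import Defs.
From HB Require Import structures.
From mathcomp Require Import all_boot all_order all_algebra.
From mathcomp Require Import all_classical all_reals all_analysis.
From mathcomp Require Import measurable_realfun.
From mathcomp Require Import ring lra.

Set Implicit Arguments.
Unset Strict Implicit.
Unset Printing Implicit Defensive.

Import Order.TTheory GRing.Theory Num.Theory.
Import numFieldNormedType.Exports.

Local Open Scope classical_set_scope.
Local Open Scope ring_scope.

(** Write t = T_0 / sigma, c = a_m / (1 - Lambda), rho = Gamma(t + Lambda) /
    Gamma(t) and M_n = g_n (W_n - c (t + n)).  By affinity, a sample with k white
    balls changes M_n by g_{n+1} delta (k - m W_n / T_n), where
    delta = a_{m-1} - a_m ([scaledS]).  Under either sampling model the mean of k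
    given the past is m W_n / T_n ([mean_transition]), so M_n is a martingale of
    constant mean W_0 - c t.  It differs from the martingale of the large-index
    case by that constant, and it is the martingale of the triangular case, where
    c = 0.

    The analytic core is that all moments of M_n stay bounded.  A second-order
    expansion of x^(2r) around M_n has no first-order contribution on average, so
    it suffices that the conditional variances of the increments are at most
    (v_n - v_{n+1}) (1 + |M_n|) for some nonnegative sequence v: the expectation
    of 1 + M_n^(2r) is then multiplied at each step by at most
    exp(C (v_n - v_{n+1})), and the exponents telescope
    ([scaled_moments_bounded]).  For large-index urns the variance is of order
    g_{n+1}^2 and v_n is a multiple of (t + n) g_n^2 ([variance_large]).  For
    triangular urns g_n^2 need not be summable, but the variance is also
    proportional to W_n / T_n, and v_n is a multiple of g_n
    ([variance_triangular]).

    Bounded moments of order 2s turn the almost sure convergence of the martingale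
    into convergence of the moments of order s ([cvg_expectation_sqr_bounded]).  As
    g_n (W_n - c n) = M_n + c t g_n with g_n tending to 0, and as n^Lambda g_n tends
    to rho ([cvg_prod_Gamma]), the limit of M_n has moments rho^s E_s
    ([limit_moments]).  The binomial formula for the shift by c t - W_0 gives the
    large-index case.

    Conditional expectations are never formed.  The first n sample counts take
    finitely many values, and summing over them replaces the next count by its
    conditional law ([expectation_draw]). *)

(** * The Gamma function *)

Section GammaFunction.
Context {R : realType}.
Local Notation mu := lebesgue_measure.

(** Weighted arithmetic-geometric mean inequality: the concave function s^l lies
    below its tangent at x. *)
Lemma powR_tangent (l x s : R) : 0 <= l -> l <= 1 -> 0 < x -> 0 < s ->
  s `^ l <= x `^ l * (1 - l) + x `^ l * l / x * s.
Proof.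
move=> l0 l1 x0 s0.
have u0 : 0 < s / x by rewrite divr_gt0.
have bern : (s / x) `^ l <= 1 - l + l * (s / x).
  rewrite /powR gt_eqF//.
  have := @convex_expR R (Itv01 l0 l1) (ln (s / x)) 0.
  rewrite !convRE/= expR0 lnK ?posrE// mulr0 addr0 mulr1 /unstable.onem.
  by rewrite [in X in _ <= X -> _]addrC.
have -> : s `^ l = x `^ l * (s / x) `^ l.
  by rewrite -powRM ?ltW// mulrC divfK// gt_eqF.
apply: le_trans (ler_wpM2l (powR_ge0 _ _) bern) _.
rewrite le_eqVlt; apply/orP; left; apply/eqP; field; exact: lt0r_neq0.
Qed.

(** Raise u <= exp u, for u = t / (2 x), to the power x. *)
Lemma powR_expR_bound (x t : R) : 0 < x -> 0 <= t ->
  t `^ x * expR (- t) <= (2 * x) `^ x * expR (- (2^-1) * t).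
Proof.
move=> x0 t0.
have y0 : 0 < 2 * x by rewrite mulr_gt0.
have -> : t `^ x = (2 * x) `^ x * (t / (2 * x)) `^ x.
  rewrite -powRM ?divr_ge0 ?(ltW y0)//.
  by rewrite [in RHS]mulrC divfK// gt_eqF.
rewrite -mulrA ler_wpM2l ?powR_ge0//.
have h : (t / (2 * x)) `^ x <= expR (2^-1 * t).
  have -> : 2^-1 * t = (t / (2 * x)) * x.
    by field; rewrite gt_eqF.
  rewrite expRM.
  rewrite ge0_ler_powR ?nnegrE ?expR_ge0 ?divr_ge0 ?(ltW x0) ?(ltW y0)//.
  by apply: le_trans (expR_ge1Dx _); rewrite lerDr.
apply: le_trans (ler_wpM2r (expR_ge0 _) h) _.
rewrite -expRD le_eqVlt; apply/orP; left; apply/eqP; congr expR; lra.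
Qed.

Definition gamma_integrand (x t : R) : R := t `^ (x - 1) * expR (- t).

Local Notation f := gamma_integrand.

Lemma measurable_gamma x (A : set R) : measurable A -> measurable_fun A (f x).
Proof.
move=> mA; apply: measurable_funTS.
apply: measurable_funM; first exact: measurable_powR.
by apply: measurableT_comp => //; exact: oppr_measurable.
Qed.

Lemma gamma_ge0 x t : 0 <= f x t.
Proof. by rewrite mulr_ge0 ?powR_ge0 ?expR_ge0. Qed.

Lemma cvg_expRNM (k : R) : 0 < k -> expR (- (k * n.+1%:R)) @[n --> \oo] --> 0.
Proof.
move=> k0.
apply: (@cvg_comp _ _ _ (fun n : nat => k * n.+1%:R) (fun z : R => expR (- z))
  _ (pinfty_nbhs R)); last exact: cvgr_expR.
apply: (@cvg_comp _ _ _ (fun n : nat => n.+1%:R) (fun z : R => k * z)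
  _ (pinfty_nbhs R)); last exact: gt0_cvgMry.
by have := @cvgr_idn R; rewrite -cvg_shiftS.
Qed.

Lemma continuous_powR (x t : R) : 0 < t -> {for t, continuous (fun s : R => s `^ x)}.
Proof.
move=> t0; apply: differentiable_continuous; apply/derivable1_diffP.
by case: (is_derive1_powR x t0).
Qed.

(** Integration by parts is done on compact subintervals of the open half-line,
    because t^(x - 1) is singular at 0 when x < 1. *)
Lemma gamma_parts (x a b : R) : 0 < x -> 0 < a -> a < b ->
  (\int[mu]_(t in `[a, b]) (x * f x t)%:E =
   (b `^ x * expR (- b) - a `^ x * expR (- a))%:E +
   \int[mu]_(t in `[a, b]) (f (x + 1) t)%:E)%E.
Proof.
move=> x0 a0 ab.
have pos (t : R) : t \in `[a, b] -> 0 < t.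
  by rewrite in_itv/= => /andP[at' _]; exact: lt_le_trans at'.
have posoo (t : R) : t \in `]a, b[ -> 0 < t.
  by rewrite in_itv/= => /andP[at' _]; exact: lt_trans at'.
have cexp (t : R) : {for t, continuous (fun t : R => expR (- t))}.
  by apply: continuous_comp; [exact: continuousN|exact: continuous_expR].
have dexp (t : R) : is_derive t 1 (fun t : R => expR (- t)) (- expR (- t)).
  have := @is_derive1_comp R expR -%R t (expR (- t)) (- 1) _ _.
  by rewrite mulrN1; exact.
transitivity (\int[mu]_(t in `[a, b]) (expR (- t) * (x * t `^ (x - 1)))%:E)%E.
  by apply: eq_integral => t _; congr EFin; rewrite /gamma_integrand; ring.
have -> := @integration_by_parts R (fun t => expR (- t)) (fun t => t `^ x)
  (fun t => - expR (- t)) (fun t => x * t `^ (x - 1)) a b ab _ _ _ _ _ _; last 6 first.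
- apply: continuous_in_subspaceT => t _; apply: cvgN; exact: cexp.
- split.
  + by move=> t _; case: (dexp t).
  + by apply: cvg_at_right_filter; exact: cexp.
  + by apply: cvg_at_left_filter; exact: cexp.
- by move=> t _; rewrite derive1E; case: (dexp t).
- apply: continuous_in_subspaceT => t; rewrite inE/= => tab.
  apply: cvgM; first exact: cvg_cst.
  exact/continuous_powR/pos.
- split.
  + move=> t /posoo t0; by case: (is_derive1_powR x t0).
  + by apply: cvg_at_right_filter; exact: continuous_powR.
  + by apply: cvg_at_left_filter; apply: continuous_powR; exact: lt_trans ab.
- by move=> t /posoo t0; rewrite powR_derive1// in_itv/= t0.
rewrite ![_ * expR _]mulrC; congr (_ + _)%E.
rewrite -integralN/=.
  apply: eq_integral => t _; rewrite /gamma_integrand addrK; congr EFin; ring.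
apply: fin_num_adde_defr; rewrite integral0_eq// => t tab.
rewrite (@le0_funeposE _ _ `[a, b]) ?inE// => s _ /=.
by rewrite lee_fin mulNr oppr_le0 mulr_ge0 ?expR_ge0 ?powR_ge0.
Qed.

(** With the lower end exp(-n) instead of 1/n, both boundary terms of the integration
    by parts vanish exponentially fast. *)
Lemma cvg_gamma_window x :
  (\int[mu]_(t in `[expR (- n.+1%:R), n.+1%:R]) (f x t)%:E @[n --> \oo] -->
   \int[mu]_(t in `]0%R, +oo[) (f x t)%:E)%E.
Proof.
have -> : `]0, +oo[%classic = \bigcup_n `[expR (- n.+1%:R), n.+1%:R]%classic :> set R.
  apply/seteqP; split => t /=; rewrite !in_itv/=.
    rewrite andbT => t0.
    pose b := Num.max t (- ln t).
    have := @cvgr_idn R; move=> /cvgryPge/(_ b)[n _ /(_ n.+1)] bn.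
    exists n => //=; rewrite in_itv/=.
    have : b <= n.+1%:R by apply: bn => /=.
    rewrite ge_max => /andP[-> lt]; rewrite andbT.
    by rewrite -[leRHS]lnK ?posrE// ler_expR lerNl.
  move=> [n _ /=]; rewrite in_itv/= andbT => /andP[+ _].
  exact/lt_le_trans/expR_gt0.
apply: ge0_nondecreasing_set_cvg_integral => //.
- move=> n m nm; rewrite subsetEset; apply: subset_itv; rewrite bnd_simp.
    by rewrite ler_expR lerN2 ler_nat.
  by rewrite ler_nat.
- by move=> n; apply/measurable_EFinP; exact: measurable_gamma.
- by move=> n t _; rewrite lee_fin gamma_ge0.
Qed.

(** The functional equation holds between extended reals, so it can be used before the
    integrals are known to be finite; finiteness for x follows from that for
    x + 1, where the integrand has no singularity. *)
Lemma gamma_integralS (x : R) : 0 < x ->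
  (\int[mu]_(t in `]0%R, +oo[) (f (x + 1) t)%:E =
   x%:E * \int[mu]_(t in `]0%R, +oo[) (f x t)%:E)%E.
Proof.
move=> x0.
pose r n : R := n.+1%:R `^ x * expR (- n.+1%:R) -
  expR (- n.+1%:R) `^ x * expR (- expR (- n.+1%:R)).
have r0 : r n @[n --> \oo] --> 0.
  rewrite -[X in _ --> X](subr0 0); apply: cvgB.
    apply: (@squeeze_cvgr _ _ _ _ (cst 0)
      (fun n => (2 * x) `^ x * expR (- (2^-1 * n.+1%:R)))).
    - near=> n; rewrite mulr_ge0 ?powR_ge0 ?expR_ge0//=.
      by rewrite -mulNr powR_expR_bound.
    - exact: cvg_cst.
    - rewrite -[X in _ --> X](mulr0 ((2 * x) `^ x)).
      by apply: cvgM; [exact: cvg_cst|exact: cvg_expRNM].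
  apply: (@squeeze_cvgr _ _ _ _ (cst 0) (fun n => expR (- (x * n.+1%:R)))).
  - near=> n; rewrite mulr_ge0 ?powR_ge0 ?expR_ge0//=.
    rewrite -expRM mulNr (mulrC _ x) ler_piMr ?expR_ge0//.
  - exact: cvg_cst.
  - exact: cvg_expRNM.
have lim1 := @cvg_gamma_window (x + 1).
have lim2 : ((r n)%:E + \int[mu]_(t in `[expR (- n.+1%:R), n.+1%:R]) (f (x + 1) t)%:E
    @[n --> \oo] --> 0%:E + \int[mu]_(t in `]0%R, +oo[) (f (x + 1) t)%:E)%E.
  by apply: cvgeD => //; apply: cvg_EFin => //; exact: nearW.
rewrite -[LHS]add0e; apply: cvg_unique lim2 _ => //.
apply: cvg_trans (cvgeZl _ (@cvg_gamma_window x)) => //.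
apply: near_eq_cvg; near=> n.
rewrite -ge0_integralZl//; last 3 first.
- by apply/measurable_EFinP; exact: measurable_gamma.
- by move=> t _; rewrite lee_fin gamma_ge0.
- by rewrite lee_fin ltW.
(* The windows are nondegenerate, as [gamma_parts] requires. *)
have n1 : expR (- n.+1%:R) < n.+1%:R :> R.
  rewrite (@lt_le_trans _ _ 1) ?expR_lt1 ?oppr_lt0 ?ltr0n//.
  by rewrite ler1n.
by under eq_integral do rewrite -EFinM; rewrite gamma_parts ?expR_gt0.
Unshelve. all: end_near. Qed.

Lemma gamma_integral_lty x : 0 < x ->
  (\int[mu]_(t in `]0%R, +oo[) (f x t)%:E < +oo)%E.
Proof.
move=> x0.
suff : (\int[mu]_(t in `]0%R, +oo[) (f (x + 1) t)%:E < +oo)%E.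
  rewrite gamma_integralS//; apply: contraTT; rewrite -!leNgt !leye_eq => /eqP ->.
  by rewrite gt0_muley ?lte_fin.
(* [powR_expR_bound] dominates the integrand by an exponential density of rate 1/2. *)
pose h t := (2 * x) `^ x * 2 * exponential_pdf 2^-1 t.
have ih : mu.-integrable `]0, +oo[ (EFin \o h).
  have -> : EFin \o h = (fun t => (((2 * x) `^ x * 2)%:E * (exponential_pdf 2^-1 t)%:E)%E).
    by apply/funext => t; rewrite -EFinM.
  apply: integrableZl => //; apply: (@integrableS _ _ _ _ setT) => //.
  exact: integrable_exponential_pdf.
have /integrableP[mh] := ih; apply: le_lt_trans.
apply: ge0_le_integral => //.
- by move=> t _; rewrite lee_fin gamma_ge0.
- by apply/measurable_EFinP; exact: measurable_gamma.
- exact: measurableT_comp.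
- move=> t /=; rewrite in_itv/= andbT => t0; rewrite lee_fin.
  apply: le_trans (ler_norm _).
  rewrite /h exponential_pdfE; last exact: ltW.
  rewrite /gamma_integrand addrK.
  apply: le_trans (powR_expR_bound x0 (ltW t0)) _.
  by rewrite !mulrA mulfK.
Qed.

Lemma integrable_gamma x : 0 < x -> mu.-integrable `]0, +oo[ (EFin \o f x).
Proof.
move=> x0; apply/integrableP; split.
  by apply/measurable_EFinP; exact: measurable_gamma.
under eq_integral do rewrite /= ger0_norm ?gamma_ge0//.
exact: gamma_integral_lty.
Qed.

Lemma GammaS (x : R) : 0 < x -> Gamma (x + 1) = x * Gamma x.
Proof.
move=> x0; rewrite /Gamma {1}/Rintegral gamma_integralS// fineM//.
exact: integrable_fin_num (integrable_gamma x0).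
Qed.

Lemma Gamma_gt0 (x : R) : 0 < x -> 0 < Gamma x.
Proof.
move=> x0; suff : 0 < Gamma (x + 1) by rewrite GammaS// pmulr_rgt0.
have xp : 0 < x + 1 by rewrite addr_gt0.
apply: (@lt_le_trans _ _ (\int[mu]_(t in `[1, 2]) expR (- 2))).
  rewrite Rintegral_cst//= lebesgue_measure_itv/= lte_fin ltr1n/=.
  by rewrite mulr_gt0 ?expR_gt0// subr_gt0 ltr1n.
have sub : (`[1, 2]%classic : set R) `<=` `]0, +oo[%classic.
  by move=> t /=; rewrite !in_itv/= andbT => /andP[t1 _]; exact: lt_le_trans t1.
apply: (@le_trans _ _ (\int[mu]_(t in `[1, 2]) f (x + 1) t)).
  apply: le_Rintegral => //.
  - apply: continuous_compact_integrable; first exact: segment_compact.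
    by apply: continuous_subspaceT => t; exact: cvg_cst.
  - by apply: integrableS (integrable_gamma xp).
  - move=> t /=; rewrite in_itv/= => /andP[t1 t2]; rewrite /gamma_integrand addrK.
    rewrite -[leLHS]mul1r ler_pM ?expR_ge0// ?ler_expR ?lerN2//.
    have h1 : 1 `^ x = 1 :> R by rewrite powR1.
    by rewrite -[leLHS]h1 ge0_ler_powR ?(ltW x0) ?nnegrE ?(le_trans _ t1).
rewrite /Gamma /Rintegral fine_le//.
- by apply: integrable_fin_num => //; apply: integrableS (integrable_gamma xp).
- by apply: integrable_fin_num => //; exact: integrable_gamma.
- apply: ge0_subset_integral => //.
  + by apply/measurable_EFinP; exact: measurable_gamma.
  + by move=> t _; rewrite lee_fin gamma_ge0.
Qed.

(** Wendel's inequality: integrate the tangent bound on s^l, taken at the point x,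
    against the Gamma density. *)
Lemma Gamma_wendel (x l : R) : 0 < x -> 0 <= l -> l <= 1 ->
  Gamma (x + l) <= x `^ l * Gamma x.
Proof.
move=> x0 l0 l1.
have xl : 0 < x + l by rewrite ltr_pwDl.
have x1 : 0 < x + 1 by rewrite addr_gt0.
have i0 := integrable_gamma x0; have i1 := integrable_gamma x1.
have -> : x `^ l * Gamma x = x `^ l * (1 - l) * Gamma x + x `^ l * l / x * Gamma (x + 1).
  by rewrite GammaS//; field; exact: lt0r_neq0.
rewrite /Gamma -!RintegralZl// -RintegralD//; last 2 first.
- exact: (integrableZl _ _ i0).
- exact: (integrableZl _ _ i1).
apply: le_Rintegral => //.
- exact: integrable_gamma.
- exact: (integrableD _ (integrableZl _ (x `^ l * (1 - l)) i0)
    (integrableZl _ (x `^ l * l / x) i1)).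
move=> t /=; rewrite in_itv/= andbT => t0.
have tn0 : t != 0 by rewrite gt_eqF.
rewrite (_ : x + l - 1 = l + (x - 1)); last by ring.
rewrite (_ : x + 1 - 1 = 1 + (x - 1)); last by ring.
rewrite (@powRD R t l) ?(@powRD R t 1) ?tn0 ?implybT// powRr1 ?(ltW t0)//.
have := ler_wpM2r (gamma_ge0 x t) (powR_tangent l0 l1 x0 t0).
rewrite /gamma_integrand => h; rewrite -[leLHS]mulrA; apply: le_trans h _.
rewrite le_eqVlt; apply/orP; left; apply/eqP.
have eqn (a b s c e : R) : (a + b * s) * (c * e) = a * (c * e) + b * (s * c * e) by ring.
exact: eqn.
Qed.

Lemma prod_Gamma (t l : R) n : 0 < t -> 0 <= l ->
  \prod_(j < n) ((t + j%:R) / (t + l + j%:R)) =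
  Gamma (t + l) / Gamma t * (Gamma (t + n%:R) / Gamma (t + l + n%:R)).
Proof.
move=> t0 l0; have tl0 : 0 < t + l by rewrite ltr_pwDl.
elim: n => [|n IH].
  rewrite big_ord0 !addr0; field.
  by rewrite !gt_eqF ?Gamma_gt0.
have tn : 0 < t + n%:R by rewrite ltr_pwDl.
have tln : 0 < t + l + n%:R by rewrite ltr_pwDl.
rewrite big_ord_recr/= IH -natr1 !addrA !GammaS//; field.
by rewrite !gt_eqF ?Gamma_gt0.
Qed.

(** Wendel's inequality with increments l and 1 - l squeezes
    n^l Gamma(t + n) / Gamma(t + l + n) between n / (t + n) and
    (t + l + n) / (t + n). *)
Lemma cvg_prod_Gamma (t l : R) : 0 < t -> 0 <= l -> l <= 1 ->
  n%:R `^ l * \prod_(j < n) ((t + j%:R) / (t + l + j%:R)) @[n --> \oo] -->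
  Gamma (t + l) / Gamma t.
Proof.
move=> t0 l0 l1; have tl0 : 0 < t + l by rewrite ltr_pwDl.
set rho := (X in _ --> X).
suff lim1 : n%:R `^ l * (Gamma (t + n%:R) / Gamma (t + l + n%:R)) @[n --> \oo] --> (1 : R).
  rewrite -[rho]mulr1.
  under eq_cvg do rewrite prod_Gamma// mulrCA.
  by apply: cvgM => //; exact: cvg_cst.
have inv0 (c : R) : 0 < c -> (c + n%:R)^-1 @[n --> \oo] --> (0 : R).
  move=> c0; apply/gtr0_cvgV0; first by near=> n; rewrite ltr_pwDl.
  by apply/cvgryPge => A; near=> n; rewrite (@le_trans _ _ n%:R) ?lerDr ?(ltW c0)//;
    near: n; exact: nbhs_infty_ger.
apply: (@squeeze_cvgr _ _ _ _ (fun n => 1 - t * (t + n%:R)^-1)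
   (fun n => 1 + l * (t + n%:R)^-1)); last 2 first.
- rewrite -[X in _ --> X]subr0 -(mulr0 t); apply: cvgB; first exact: cvg_cst.
  by apply: cvgM; [exact: cvg_cst|exact: inv0].
- rewrite -[X in _ --> X]addr0 -(mulr0 l); apply: cvgD; first exact: cvg_cst.
  by apply: cvgM; [exact: cvg_cst|exact: inv0].
near=> n.
have n0 : 0 < n%:R :> R by rewrite ltr0n; near: n; exact: nbhs_infty_gt.
have y0 : 0 < t + n%:R by rewrite addr_gt0.
have yl0 : 0 < t + l + n%:R by rewrite addr_gt0.
have G0 := Gamma_gt0 y0; have G1 := Gamma_gt0 yl0.
have up := Gamma_wendel y0 l0 l1.
have := @Gamma_wendel (t + l + n%:R) (1 - l) yl0.
rewrite subr_ge0 gerBl => /(_ l1 l0).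
rewrite (_ : t + l + n%:R + (1 - l) = t + n%:R + 1); last by ring.
rewrite GammaS// => low.
rewrite (_ : t + n%:R + l = t + l + n%:R) in up; last by ring.
apply/andP; split.
  rewrite mulrA ler_pdivlMr//.
  have -> : 1 - t * (t + n%:R)^-1 = n%:R / (t + n%:R) by field; exact: lt0r_neq0.
  have q0 : 0 < n%:R / (t + n%:R) by rewrite divr_gt0.
  have q1 : n%:R / (t + n%:R) <= (n%:R / (t + n%:R)) `^ l.
    by rewrite ger1_powR// q0/= ler_pdivrMr// mul1r lerDr ltW.
  apply: le_trans (ler_wpM2r (ltW G1) q1) _.
  apply: le_trans (ler_wpM2l (powR_ge0 _ _) up) _.
  by rewrite mulrA -powRM ?(ltW y0) ?(ltW q0)// divfK// gt_eqF.
rewrite mulrA ler_pdivrMr//.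
have y1 : t + n%:R + l = t + l + n%:R by ring.
have -> : 1 + l * (t + n%:R)^-1 = (t + l + n%:R) / (t + n%:R).
  by field; exact: lt0r_neq0.
have h1 : n%:R `^ l <= (t + l + n%:R) `^ l.
  by rewrite ge0_ler_powR ?nnegrE ?(ltW n0) ?(ltW yl0)// lerDr ltW.
rewrite [leRHS]mulrAC ler_pdivlMr// -mulrA [Gamma _ * _]mulrC.
apply: le_trans (ler_wpM2l (powR_ge0 _ _) low) _.
apply: le_trans (ler_wpM2r _ h1) _.
  by rewrite mulr_ge0 ?powR_ge0 ?ltW.
rewrite mulrA -powRD; last by apply/implyP => _; rewrite gt_eqF.
by rewrite subrKC powRr1 ?(ltW yl0).
Unshelve. all: end_near.
Qed.

End GammaFunction.

(** * Convergence of expectations under bounded second moments *)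

Section SquareBounded.
Context {R : realType} {d : measure_display} {T : measurableType d}.
Variable P : probability T R.
Implicit Types (X : nat -> T -> R) (f Y : T -> R).

Lemma integrable_sqr f : measurable_fun setT f ->
  (\int[P]_w ((f w) ^+ 2)%:E < +oo)%E -> P.-integrable setT (fun w => ((f w) ^+ 2)%:E).
Proof.
move=> mf f2; apply/integrableP; split.
  by apply/measurable_EFinP; exact: measurable_funX.
by under eq_integral do rewrite /= ger0_norm ?sqr_ge0//.
Qed.

Lemma integrable_of_sqr f : measurable_fun setT f ->
  P.-integrable setT (fun w => ((f w) ^+ 2)%:E) -> P.-integrable setT (EFin \o f).
Proof.
move=> mf if2.
have i1 := finite_measure_integrable_cst P 1 (@measurableT _ T).
apply: le_integrable (integrableD measurableT i1 if2) => //.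
  exact/measurable_EFinP.
move=> w _ /=; rewrite lee_fin.
apply: le_trans (ler_norm _).
by rewrite -real_normK ?num_real//; have := normr_ge0 (f w); nra.
Qed.

Lemma fatou_sqr X Y (C : R) :
  (forall n, measurable_fun setT (X n)) -> measurable_fun setT Y ->
  {ae P, forall w, X n w @[n --> \oo] --> Y w} ->
  (forall n, \int[P]_w ((X n w) ^+ 2)%:E <= C%:E)%E ->
  (\int[P]_w ((Y w) ^+ 2)%:E <= C%:E)%E.
Proof.
move=> mX mY XY XC.
pose F n w := ((X n w) ^+ 2)%:E : \bar R.
have mF n : measurable_fun setT (F n).
  by apply/measurable_EFinP; exact: measurable_funX.
have -> : (\int[P]_w ((Y w) ^+ 2)%:E = \int[P]_w limn_einf (F ^~ w))%E.
  apply: ae_eq_integral => //.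
  - by apply/measurable_EFinP; exact: measurable_funX.
  - rewrite /limn_einf; apply: measurableT_comp => //.
    by apply: measurable_fun_limn_esup => n; exact: measurableT_comp.
  - apply: filterS XY => w XYw _.
    have cv : F ^~ w @ \oo --> ((Y w) ^+ 2)%:E.
      apply: cvg_EFin; first exact: nearW.
      have -> : fine \o F ^~ w = (fun n => X n w * X n w) by apply/funext => n; rewrite -expr2.
      by rewrite expr2; exact: cvgM.
    by have [-> _] := cvg_limn_einf_sup cv.
apply: le_trans (fatou P measurableT mF _) _.
  by move=> n w _; rewrite lee_fin sqr_ge0.
have [<- _] := @cvg_limn_einf_sup R (fun=> C%:E) C%:E (cvg_cst _).
rewrite !limn_einf_lim; apply: lee_lim.
- exact: is_cvg_einfs.
- exact: is_cvg_einfs.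
- apply: nearW => n; apply: le_ereal_inf_tmp => _ [m /= nm <-].
  by apply: le_trans (XC m); apply: ereal_inf_lbound; exists m.
Qed.

(** A bound in L2 gives uniform integrability: with D the distance to the limit,
    D <= min(D, A) + D^2 / A, where the first term is handled by dominated
    convergence and the second one is small for large A. *)
Lemma cvg_expectation_sqr_bounded X Y (C : R) :
  (forall n, measurable_fun setT (X n)) -> measurable_fun setT Y ->
  {ae P, forall w, X n w @[n --> \oo] --> Y w} ->
  (forall n, \int[P]_w ((X n w) ^+ 2)%:E <= C%:E)%E ->
  P.-integrable setT (EFin \o Y) /\
  (\int[P]_w X n w) @[n --> \oo] --> (\int[P]_w Y w).
Proof.
move=> mX mY XY XC.
have Y2 := fatou_sqr mX mY XY XC.
have iX2 n := integrable_sqr (mX n) (le_lt_trans (XC n) (ltry _)).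
have iY2 := integrable_sqr mY (le_lt_trans Y2 (ltry _)).
have iX n := integrable_of_sqr (mX n) (iX2 n).
have iY := integrable_of_sqr mY iY2.
split; first exact: iY.
pose D n w := `|X n w - Y w|.
have mD n : measurable_fun setT (D n).
  by apply: measurableT_comp => //; exact: measurable_funB.
have iD n : P.-integrable setT (EFin \o D n).
  by have := integrable_abse (integrableB measurableT (iX n) iY).
pose S n w := 2 * (X n w) ^+ 2 + 2 * (Y w) ^+ 2.
have iS n : P.-integrable setT (EFin \o S n).
  exact: (integrableD measurableT (integrableZl measurableT 2 (iX2 n))
    (integrableZl measurableT 2 iY2)).
have C0 : 0 <= C.
  rewrite -lee_fin; apply: le_trans (XC 0).
  by apply: integral_ge0 => w _; rewrite lee_fin sqr_ge0.
have S4 n : \int[P]_w S n w <= 4 * C.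
  have rle f : P.-integrable setT (fun w => ((f w) ^+ 2)%:E) ->
     (\int[P]_w ((f w) ^+ 2)%:E <= C%:E)%E -> \int[P]_w ((f w) ^+ 2) <= C.
    by move=> i h; rewrite -lee_fin fineK//; exact: integrable_fin_num.
  have h1 := rle _ (iX2 n) (XC n); have h2 := rle _ iY2 Y2.
  rewrite RintegralD//; last 2 first.
    exact: (integrableZl measurableT 2 (iX2 n)).
    exact: (integrableZl measurableT 2 iY2).
  rewrite (RintegralZl _ _ (iX2 n))// (RintegralZl _ _ iY2)//.
  have -> : 4 * C = 2 * C + 2 * C by ring.
  by apply: lerD; rewrite ler_pM2l.
apply/cvgrPdist_le => e e0.
(* The squared distances have mean at most 4 C, so this A makes D^2 / A small. *)
pose A := 8 * C / e + 1.
have A0 : 0 < A by rewrite ltr_wpDl// divr_ge0 ?mulr_ge0// ltW.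
have mm n : measurable_fun setT (fun w => Num.min (D n w) A).
  by apply: measurable_minr.
have i_A := finite_measure_integrable_cst P A (@measurableT _ T).
have minE n w : `|Num.min (D n w) A| = Num.min (D n w) A.
  by rewrite ger0_norm// le_min normr_ge0 ltW.
have im n : P.-integrable setT (EFin \o (fun w => Num.min (D n w) A)).
  apply: le_integrable i_A => //; first exact/measurable_EFinP.
  by move=> w _ /=; rewrite lee_fin minE (ger0_norm (ltW A0)) ge_min lexx orbT.
have dct : \int[P]_w Num.min (D n w) A @[n --> \oo] --> 0.
  have [| | | | |_ _] := @dominated_convergence _ T R P setT measurableT
    (fun n w => (Num.min (D n w) A)%:E) (cst 0%E) (cst A%:E).
  - by move=> n; exact/measurable_EFinP.
  - exact: measurable_cst.
  - apply: filterS XY => w XYw _; apply: cvg_EFin; first exact: nearW.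
    have D0 : D n w @[n --> \oo] --> 0.
      apply/norm_cvg0P; rewrite -(subrr (Y w)); apply: cvgB => //; exact: cvg_cst.
    apply: (@squeeze_cvgr _ _ _ _ (cst 0) (D ^~ w)) => //; last exact: cvg_cst.
    by near=> n; rewrite /= le_min normr_ge0 (ltW A0)/= ge_min lexx.
  - exact: i_A.
  - by apply: aeW => w n _; rewrite lee_fin minE ge_min lexx orbT.
  rewrite integral0_eq// => h.
  by move/fine_cvgP : h => [_].

move/cvgrPdist_le : dct => /(_ (e / 2)); rewrite divr_gt0// => /(_ isT).
apply: filterS => n; rewrite sub0r normrN => small.
rewrite distrC -RintegralB//.
apply: le_trans (le_normr_Rintegral _ _) _ => //.
  exact: (integrableB measurableT (iX n) iY).
apply: (@le_trans _ _ (\int[P]_w (Num.min (D n w) A + A^-1 * S n w))).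
  apply: le_Rintegral => //.
  - exact: iD.
  - exact: (integrableD measurableT (im n) (integrableZl measurableT _ (iS n))).
  - move=> w _; rewrite -/(D n w).
    have S0 : 0 <= A^-1 * S n w.
      by rewrite mulr_ge0 ?invr_ge0 ?(ltW A0)// addr_ge0// mulr_ge0// sqr_ge0.
    have [DA|AD] := leP (D n w) A; first by rewrite lerDl.
    have DS : D n w ^+ 2 <= S n w.
      rewrite /D /S real_normK ?num_real// -subr_ge0.
      by rewrite (_ : _ - _ = (X n w + Y w) ^+ 2) ?sqr_ge0//; ring.
    have : D n w <= A^-1 * S n w.
      rewrite mulrC ler_pdivlMr//; apply: le_trans DS; rewrite expr2.
      by rewrite ler_wpM2l ?normr_ge0// ltW.
    by move=> h; rewrite (le_trans h)// lerDr ltW.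
rewrite RintegralD//; last exact: (integrableZl measurableT _ (iS n)).
rewrite RintegralZl//.
have h1 : A^-1 * \int[P]_w S n w <= e / 2.
  rewrite mulrC ler_pdivrMr//; apply: le_trans (S4 n) _.
  rewrite /A mulrDr mulr1.
  have -> : e / 2 * (8 * C / e) = 4 * C by field; exact: lt0r_neq0.
  by rewrite lerDl divr_ge0// ltW.
have := ler_norm (\int[P]_w Num.min (D n w) A).
by clear -h1 small; lra.
Unshelve. all: end_near. Qed.

End SquareBounded.

(** * Moments of one sample *)

Section Sampling.
Variable u : urn.
Local Notation m := (ssize u).

Lemma sum_favourable M w c :
  (\sum_(k < m.+1) favourable u M w c k = outcomes u M w c)%N.
Proof.
case: M => /=; first exact: binomial.Vandermonde.
rewrite addnC expnDn; apply: eq_bigr => k _.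
by rewrite -mulnA [(w ^ k * _)%N]mulnC.
Qed.

(** The mean number of white balls, cleared of denominators: removing one marked ball
    reduces the identity to the number of outcomes of a sample of size m - 1. *)
Lemma sum_favourable_mean M w c :
  ((w + c) * \sum_(k < m.+1) k * favourable u M w c k = m * w * outcomes u M w c)%N.
Proof.
case: M => /=; case: m => [|p].
- by rewrite big_ord1 mul0n muln0.
- rewrite big_ord_recl/= mul0n add0n; case: w => [|w].
    rewrite big1 ?muln0// => i _.
    by rewrite bin0n/= mul0n muln0.
  have -> : (\sum_(i < p.+1) bump 0 i * ('C(w.+1, bump 0 i) * 'C(c, p.+1 - bump 0 i)) =
    w.+1 * 'C(w + c, p))%N.
    rewrite -binomial.Vandermonde big_distrr/=; apply: eq_bigr => i _.
    by rewrite /bump add1n subSS mulnA -mul_bin_diag mulnA.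
  have := mul_bin_diag (w + c).+1 p; rewrite /= addSn => e.
  by rewrite mulnCA e mulnCA mulnA mulnC.
- by rewrite big_ord1 mul0n muln0.
- rewrite big_ord_recl/= mul0n add0n.
  have -> : (\sum_(i < p.+1) bump 0 i *
      ('C(p.+1, bump 0 i) * w ^ bump 0 i * c ^ (p.+1 - bump 0 i)) =
    p.+1 * w * (w + c) ^ p)%N.
    rewrite [(w + c)%N]addnC expnDn big_distrr/=; apply: eq_bigr => i _.
    rewrite /bump add1n subSS !mulnA -mul_bin_diag/= expnS.
    by rewrite -!mulnA; congr muln; rewrite mulnCA; congr muln; congr muln; rewrite mulnC.
  by rewrite mulnCA expnS.
Qed.

End Sampling.

(** * Expectations over finitely many histories *)

Section FiniteValued.
Context {R : realType} {d : measure_display} {T : measurableType d}.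
Variable P : probability T R.
Variables (I : finType) (Z : T -> I).
Hypothesis mZ : forall i, measurable [set w | Z w = i].
Variable F : I -> R.

Let FE w : (F (Z w))%:E = (\sum_i (F i)%:E * (\1_[set w | Z w = i] w)%:E)%E.
Proof.
rewrite (bigD1 (Z w))//= indicE mem_set// mule1 big1 ?adde0// => i.
rewrite indicE => iZ; rewrite memNset ?mule0//= => /esym/eqP.
by rewrite (negbTE iZ).
Qed.

Let integrable_fiber i : P.-integrable setT (fun w => (\1_[set w | Z w = i] w)%:E).
Proof.
apply/integrableP; split; first by apply/measurable_EFinP; exact: measurable_indic.
under eq_integral do rewrite /= ger0_norm//.
rewrite integral_indic// setIT.
by apply: le_lt_trans (probability_le1 P _) _ => //; rewrite ltry.
Qed.

Lemma integrable_finite_valued : P.-integrable setT (EFin \o (fun w => F (Z w))).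
Proof.
have -> : EFin \o (fun w => F (Z w)) =
    (fun w => \sum_i (F i)%:E * (\1_[set w | Z w = i] w)%:E)%E.
  by apply/funext => w /=; rewrite FE.
by apply: integrable_sum => // i _; exact: integrableZl.
Qed.

Lemma expectation_finite_valued :
  \int[P]_w F (Z w) = \sum_i F i * fine (P [set w | Z w = i]).
Proof.
rewrite /Rintegral.
under eq_integral do rewrite FE.
rewrite integral_sum//; last by move=> i; exact: integrableZl.
rewrite -[RHS]/(fine (_)%:E) -sumEFin; congr fine; apply: eq_bigr => i _.
by rewrite integralZl// integral_indic// setIT EFinM fineK// fin_num_measure.
Qed.

End FiniteValued.

Section Histories.
Context {R : realType} (u : urn) (M : sampling).
Context {d : measure_display} {T : measurableType d} {P : probability T R}.
Variable K : nat -> {RV P >-> nat}.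
Hypothesis hK : urn_process u K M.
Local Notation m := (ssize u).
Local Notation history n := {ffun 'I_n -> 'I_m.+1}.

(** The value 0 outside the domain keeps every count at most m. *)
Definition draws n (h : history n) : nat -> nat :=
  fun i => if insub i is Some j then h j else 0%N.

Definition sample_path n (w : T) : history n := [ffun i : 'I_n => inord (K i w)].

Definition cylinder (h : nat -> nat) n : set T := [set w | forall i, (i < n)%N -> K i w = h i].

Lemma draws_lt n (h : history n) (i : 'I_n) : draws h i = h i.
Proof.
rewrite /draws; case: insubP => [j _ ji|]; last by rewrite ltn_ord.
by congr (nat_of_ord (h _)); exact: val_inj.
Qed.

Lemma draws_le n (h : history n) i : (draws h i <= m)%N.
Proof. by rewrite /draws; case: insub => // j; rewrite -ltnS. Qed.

Lemma sample_path_fiber n (h : history n) :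
  [set w | sample_path n w = h] = cylinder (draws h) n.
Proof.
have [Km _] := hK.
apply/seteqP; split => w /=.
  by move=> <- i lt_in; rewrite (draws_lt _ (Ordinal lt_in)) ffunE inordK// ltnS.
move=> wh; apply/ffunP => i; apply: val_inj.
by rewrite ffunE /= inordK ?ltnS// (wh _ (ltn_ord i)) draws_lt.
Qed.

Lemma draws_sample_path n w i : (i < n)%N -> draws (sample_path n w) i = K i w.
Proof.
move=> lt_in.
by have := sample_path_fiber (sample_path n w) => /seteqP[+ _] => /(_ w erefl) /(_ i lt_in).
Qed.

Lemma measurable_cylinder h n : measurable (cylinder h n).
Proof.
have -> : cylinder h n = \bigcap_(i in `I_n) (K i @^-1` [set h i]).
  by apply/seteqP; split => w /= wh i /=; exact: wh.
apply: bigcap_measurableType => i _.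
by rewrite -[X in measurable X]setTI; exact: measurable_funP.
Qed.

Lemma measurable_sample_path n (h : history n) : measurable [set w | sample_path n w = h].
Proof. by rewrite sample_path_fiber; exact: measurable_cylinder. Qed.

Lemma white_eq (h h' : nat -> nat) n : (forall i, (i < n)%N -> h i = h' i) ->
  white u h n = white u h' n.
Proof. by move=> e; rewrite /white; congr (_ + _); apply: eq_bigr => i _; rewrite e. Qed.

Lemma black_eq (h h' : nat -> nat) n : (forall i, (i < n)%N -> h i = h' i) ->
  black u h n = black u h' n.
Proof. by move=> e; rewrite /black; congr (_ + _); apply: eq_bigr => i _; rewrite e. Qed.

Lemma cylinder_next h n : (forall i, (i <= n)%N -> (h i <= m)%N) ->
  P (cylinder h n.+1) =
  (P (cylinder h n) * (draw_prob u R M (white u h n) (black u h n) (h n))%:E)%E.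
Proof. by move=> hm; have [_ ->] := hK. Qed.

(** A factor of the product formula vanishes as soon as one draw has no favourable
    outcome.  Hence only feasible histories carry mass, and along these tenability
    keeps both colours nonnegative. *)
Lemma cylinder_feasible h n : (forall i, (i < n)%N -> (h i <= m)%N) ->
  P (cylinder h n) != 0%E -> feasible u M h n.
Proof.
move=> hm Pn0 i lt_in; split; first exact: hm.
have : P (cylinder h i.+1) != 0%E.
  apply: contra_neq Pn0 => P0; apply/eqP; rewrite eq_le measure_ge0 andbT -P0.
  apply: le_measure; rewrite ?inE; try exact: measurable_cylinder.
  by move=> w /= wh j ji; apply: wh; exact: leq_trans lt_in.
rewrite cylinder_next//; last by move=> j ji; apply: hm; exact: leq_trans lt_in.
apply: contra_neqT; rewrite -eqn0Ngt => /eqP.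
by rewrite /draw_prob => ->; rewrite mul0r mule0.
Qed.

(** The pair made of the first n counts and the next one takes finitely many values,
    and the law of this pair is the product formula. *)
Lemma expectation_next n (F : history n -> nat -> R) :
  \int[P]_w F (sample_path n w) (K n w) =
  \sum_h (\sum_(k < m.+1)
    draw_prob u R M (white u (draws h) n) (black u (draws h) n) k * F h k) *
    fine (P (cylinder (draws h) n)).
Proof.
have [Km _] := hK.
pose Z w : history n * 'I_m.+1 := (sample_path n w, inord (K n w)).
pose ext (hk : history n * 'I_m.+1) i := if (i < n)%N then draws hk.1 i else hk.2 : nat.
have fZ hk : [set w | Z w = hk] = cylinder (ext hk) n.+1.
  apply/seteqP; split => w /=.
    move=> <- i; rewrite ltnS leq_eqVlt => /predU1P[->|lt_in].
      by rewrite /ext ltnn /= inordK ?ltnS.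
    by rewrite /ext lt_in/= draws_sample_path.
  case: hk => h k wh; rewrite /Z; congr pair.
    have : cylinder (draws h) n w.
      by move=> i lt_in; rewrite wh; [rewrite /ext lt_in|rewrite ltnS ltnW].
    by rewrite -sample_path_fiber.
  by apply: val_inj; rewrite /= inordK ?ltnS// wh// /ext ltnn.
have mZ hk : measurable [set w | Z w = hk] by rewrite fZ; exact: measurable_cylinder.
transitivity (\int[P]_w (fun hk : history n * 'I_m.+1 => F hk.1 hk.2) (Z w)).
  by apply: eq_Rintegral => w _; rewrite /= inordK ?ltnS.
rewrite (expectation_finite_valued P mZ (fun hk : history n * 'I_m.+1 => F hk.1 hk.2)).
transitivity (\sum_(h : history n) \sum_(k < m.+1) F h k * fine (P [set w | Z w = (h, k)])).
  by rewrite pair_bigA; apply: eq_bigr => -[h k].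
apply: eq_bigr => h _; rewrite big_distrl/=; apply: eq_bigr => k _.
have exth i : (i < n)%N -> ext (h, k) i = draws h i by rewrite /ext => ->.
have extn : ext (h, k) n = k by rewrite /ext ltnn.
rewrite fZ cylinder_next//; last first.
  by move=> i _; rewrite /ext; case: ifP => _; [exact: draws_le|rewrite /= -ltnS].
rewrite (white_eq exth) (black_eq exth) extn.
have -> : cylinder (ext (h, k)) n = cylinder (draws h) n.
  by apply/seteqP; split => w wh i lt_in; rewrite wh// exth.
rewrite fineM//; last by rewrite fin_num_measure//; exact: measurable_cylinder.
by rewrite /=; ring.
Qed.

End Histories.

Section States.
Context {R : realType} (u : urn) (M : sampling).
Context {d : measure_display} {T : measurableType d} {P : probability T R}.
Variable K : nat -> {RV P >-> nat}.
Hypothesis hu : urn_assumptions u M.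
Hypothesis hK : urn_process u K M.
Local Notation m := (ssize u).

Definition state n (w : T) : int := white u (fun i => K i w) n.

(** The number of black balls is determined by the state because the urn is balanced. *)
Definition transition n (x : int) (k : nat) : R :=
  draw_prob u R M x ((total_balls u n)%:Z - x) k.

Lemma total_balls_ge n : (m <= total_balls u n)%N.
Proof. by case: hu => -[_ _ mt] _; rewrite (leq_trans mt)// leq_addr. Qed.

Lemma total_balls_gt0 n : (0 < total_balls u n)%N.
Proof. by apply: leq_trans (total_balls_ge n); case: hu => -[]. Qed.

Lemma white_black h n : (forall i, (i < n)%N -> (h i <= m)%N) ->
  white u h n + black u h n = (total_balls u n)%:Z.
Proof.
case: hu => _ [bal _ _] hm.
rewrite /white /black /total_balls /total0 addrACA -big_split/=.
rewrite (eq_bigr (fun=> (balance u)%:Z)); last by move=> i _; rewrite bal// leq_subr.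
by rewrite sumr_const card_ord !PoszD PoszM -mulr_natr natz.
Qed.

Lemma outcomes_gt0 w c : (0 < w + c)%N -> (m <= w + c)%N -> (0 < outcomes u M w c)%N.
Proof. by case: M => /=; [rewrite bin_gt0|rewrite expn_gt0 => ->]. Qed.

Section TransitionSums.
Variables (n : nat) (x : int).
Hypotheses (x0 : 0 <= x) (xT : x <= (total_balls u n)%:Z).

Lemma state_colors : exists w c,
  [/\ x = w%:Z, (total_balls u n)%:Z - x = c%:Z & (w + c)%N = total_balls u n].
Proof.
have : 0 <= (total_balls u n)%:Z - x by rewrite subr_ge0.
case: x x0 => // w _ h.
exists w, (total_balls u n - w)%N.
have le : (w <= total_balls u n)%N by rewrite -lez_nat -subr_ge0.
by rewrite subzn// subnKC.
Qed.

Lemma sum_transition : \sum_(k < m.+1) transition n x k = 1.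
Proof.
have [w [c [-> e wc]]] := state_colors; rewrite /transition e /draw_prob !absz_nat.
rewrite -big_distrl/= -natr_sum sum_favourable divff// pnatr_eq0 -lt0n.
by rewrite outcomes_gt0 ?wc ?total_balls_gt0 ?total_balls_ge.
Qed.

Lemma transition_ge0 k : 0 <= transition n x k.
Proof. by rewrite divr_ge0. Qed.

Lemma mean_transition :
  \sum_(k < m.+1) transition n x k * k%:R = m%:R * x%:~R / (total_balls u n)%:R.
Proof.
have [w [c [-> e wc]]] := state_colors; rewrite /transition e /draw_prob !absz_nat.
have out0 : (outcomes u M w c)%:R != 0 :> R.
  by rewrite pnatr_eq0 -lt0n outcomes_gt0 ?wc ?total_balls_gt0 ?total_balls_ge.
have T0 : (total_balls u n)%:R != 0 :> R by rewrite pnatr_eq0 -lt0n total_balls_gt0.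
have := congr1 (fun i => i%:R : R) (sum_favourable_mean u M w c).
rewrite wc !natrM natr_sum => h.
apply: (mulfI T0); apply: (mulIf out0); rewrite -[_%:~R]/(w%:R).
rewrite [_ * (_ / _)]mulrC divfK//.
rewrite -h -mulrA; congr (_ * _).
rewrite big_distrl/=; apply: eq_bigr => k _.
by rewrite mulrAC divfK// natrM mulrC.
Qed.

End TransitionSums.

Lemma state_sample_path n w : white u (draws (sample_path u K n w)) n = state n w.
Proof. by apply: white_eq => i lt_in; rewrite (draws_sample_path hK). Qed.

Lemma integrable_state n (f : int -> R) : P.-integrable setT (EFin \o (fun w => f (state n w))).
Proof.
have -> : (fun w => f (state n w)) =
    (fun w => (fun h : {ffun 'I_n -> 'I_m.+1} => f (white u (draws h) n)) (sample_path u K n w)).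
  by apply/funext => w; rewrite state_sample_path.
exact: (integrable_finite_valued P (measurable_sample_path hK (n:=n))
  (fun h : {ffun 'I_n -> 'I_m.+1} => f (white u (draws h) n))).
Qed.

Lemma measurable_state n (f : int -> R) : measurable_fun setT (fun w => f (state n w)).
Proof. exact/measurable_EFinP/measurable_int/integrable_state. Qed.

(** States outside [0, T_n] have probability zero, so bounds on expectations may ignore
    them. *)
Lemma expectation_state_le n (f g : int -> R) :
  (forall x, 0 <= x -> x <= (total_balls u n)%:Z -> f x <= g x) ->
  \int[P]_w f (state n w) <= \int[P]_w g (state n w).
Proof.
move=> fg; pose wh (h : {ffun 'I_n -> 'I_m.+1}) := white u (draws h) n.
have E (e : int -> R) : \int[P]_w e (state n w) =
    \sum_h e (wh h) * fine (P [set w | sample_path u K n w = h]).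
  rewrite -(expectation_finite_valued P (measurable_sample_path hK (n:=n)) (fun h => e (wh h))).
  by apply: eq_Rintegral => w _; rewrite /wh state_sample_path.
rewrite !E.
apply: ler_sum => h _; rewrite (sample_path_fiber hK).
have [->|C0] := eqVneq (P (cylinder K (draws h) n)) 0%E; first by rewrite !mulr0.
rewrite ler_wpM2r ?fine_ge0//.
have feas := cylinder_feasible hK (fun i _ => draws_le h i) C0.
have [w0 b0] : 0 <= white u (draws h) n /\ 0 <= black u (draws h) n.
  by case: hu => _ [_ _ [ten _]]; exact: ten.
have wb := white_black (fun i (_ : (i < n)%N) => draws_le h i).
by apply: fg; rewrite // -wb lerDl.
Qed.

Lemma expectation_draw n (F : int -> nat -> R) :
  \int[P]_w F (state n w) (K n w) =
  \int[P]_w \sum_(k < m.+1) transition n (state n w) k * F (state n w) k.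
Proof.
pose wh (h : {ffun 'I_n -> 'I_m.+1}) := white u (draws h) n.
transitivity (\int[P]_w (fun h => F (wh h)) (sample_path u K n w) (K n w)).
  by apply: eq_Rintegral => w _; rewrite /wh state_sample_path.
transitivity (\int[P]_w (fun h => \sum_(k < m.+1) transition n (wh h) k * F (wh h) k)
    (sample_path u K n w)); last by apply: eq_Rintegral => w _; rewrite /wh state_sample_path.
rewrite (expectation_next hK (fun h => F (wh h))).
rewrite (expectation_finite_valued P (measurable_sample_path hK (n:=n))
  (fun h => \sum_(k < m.+1) transition n (wh h) k * F (wh h) k)).
apply: eq_bigr => h _; rewrite (sample_path_fiber hK); congr (_ * _).
apply: eq_bigr => k _; congr (_ * _); rewrite /transition; congr draw_prob.
have := white_black (fun i (_ : (i < n)%N) => draws_le h i).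
by rewrite /wh => <-; rewrite addrAC subrr add0r.
Qed.

End States.

(** * Second-order expansion of powers *)

Section PowerStep.
Context {R : realFieldType}.

(** The weight (1 + |x|)^q, one degree above the natural q - 1, leaves the induction
    free of truncated subtraction; it is still good enough, since multiplied by
    1 + |x| it is at most a constant times 1 + x^(q+1) for odd q. *)
Lemma power_step (q : nat) (c0 : R) : 0 <= c0 -> exists2 C : R, 0 <= C &
  forall x e, `|e| <= c0 ->
  `|(x + e) ^+ q.+1 - x ^+ q.+1 - q.+1%:R * x ^+ q * e| <= C * e ^+ 2 * (1 + `|x|) ^+ q.
Proof.
move=> c00; elim: q => [|q [C C0 IH]].
  exists 0 => // x e _; rewrite (_ : _ - _ = 0) ?normr0 ?mul0r//; ring.
exists (q.+1%:R + (1 + c0) * C) => [|x e ec].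
  by rewrite addr_ge0// mulr_ge0// addr_ge0.
have {}IH := IH x e ec.
set r := (X in `|X| <= _) in IH.
have -> : (x + e) ^+ q.+2 - x ^+ q.+2 - q.+2%:R * x ^+ q.+1 * e =
    q.+1%:R * x ^+ q * e ^+ 2 + (x + e) * r.
  rewrite /r !exprS -[q.+2%:R]natr1; ring.
have x1 : 1 <= 1 + `|x| by rewrite lerDl.
have x10 : 0 <= 1 + `|x| by rewrite addr_ge0.
apply: le_trans (ler_normD _ _) _.
rewrite -[leRHS]mulrA [leRHS]mulrDl; apply: lerD.
  have e2 : `|e ^+ 2| = e ^+ 2 by rewrite ger0_norm ?sqr_ge0.
  rewrite normrM e2 normrM normr_nat normrX -mulrA ler_wpM2l//.
  rewrite mulrC ler_wpM2l ?sqr_ge0//.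
  rewrite exprS -[leLHS]mul1r; apply: ler_pM => //; rewrite ?exprn_ge0//.
  by rewrite lerXn2r ?nnegrE// lerDr.
rewrite normrM [_ ^+ q.+1]exprS.
have xe : `|x + e| <= (1 + c0) * (1 + `|x|).
  apply: le_trans (ler_normD _ _) _.
  by have := normr_ge0 x; nra.
apply: le_trans (ler_pM _ _ xe IH) _ => //.
by rewrite le_eqVlt; apply/orP; left; apply/eqP; ring.
Qed.

Lemma power_weight (x : R) r : (1 + `|x|) ^+ r.*2 <= 2 ^+ r.*2 * (1 + x ^+ r.*2).
Proof.
have xr : 0 <= x ^+ r.*2 by rewrite -mul2n exprM exprn_ge0// sqr_ge0.
have -> : x ^+ r.*2 = `|x| ^+ r.*2 by rewrite -normrX ger0_norm.
have [x1|x1] := leP `|x| 1.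
  apply: (@le_trans _ _ (2 ^+ r.*2)).
    by rewrite lerXn2r ?nnegrE ?addr_ge0//; lra.
  by rewrite ler_peMr ?exprn_ge0// lerDl exprn_ge0.
apply: (@le_trans _ _ ((2 * `|x|) ^+ r.*2)).
  by rewrite lerXn2r ?nnegrE ?addr_ge0 ?mulr_ge0//; lra.
by rewrite exprMn ler_wpM2l ?exprn_ge0// lerDr.
Qed.

End PowerStep.

(** * The scaled martingale and its moments *)

Lemma expectation_constant {R : realType} {d : measure_display} {T : measurableType d}
  (P : probability T R) (r : R) : \int[P]_w r = r.
Proof.
rewrite Rintegral_cst//; suff -> : fine (P [set: T]) = 1 by rewrite mulr1.
by apply: EFin_inj; rewrite fineK ?fin_num_measure//; exact: probability_setT.
Qed.

Section UrnMoments.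
Context {R : realType} (u : urn) (M : sampling).
Context {d : measure_display} {T : measurableType d} {P : probability T R}.
Variable K : nat -> {RV P >-> nat}.
Hypothesis hu : urn_assumptions u M.
Hypothesis hK : urn_process u K M.
Local Notation m := (ssize u).
Local Notation a := (whiteadd u).
Local Notation sigma := (balance u).
Local Notation L := (Lambda u R).
Local Notation c := (drift u R).
Local Notation t := ((total0 u)%:R / sigma%:R : R).
Local Notation delta := ((a m.-1 - a m)%:~R : R).
Hypothesis L0 : 0 < L.
Hypothesis cL : c * (1 - L) = (a m)%:~R.

(** The affine function c (t + n) of n solves the recursion of the mean of W_n exactly;
    subtracting it, rather than c n, makes this a martingale. *)
Definition scaled n (x : int) : R := g u R n * (x%:~R - c * (t + n%:R)).

Let sigma0 : 0 < sigma%:R :> R.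
Proof. by case: hu => -[_ s1 _] _; rewrite ltr0n. Qed.

Let t0 : 0 < t.
Proof.
rewrite divr_gt0// ltr0n.
by have := total_balls_gt0 hu 0; rewrite /total_balls muln0 addn0.
Qed.

Let m0 : 0 < m%:R :> R.
Proof. by case: hu => -[m1 _ _] _; rewrite ltr0n. Qed.

Let mdelta : m%:R * delta = sigma%:R * L.
Proof. by rewrite /Lambda; field; exact: lt0r_neq0. Qed.

Let delta0 : 0 < delta.
Proof. by rewrite -(pmulr_rgt0 _ m0) mdelta mulr_gt0. Qed.

Let totalE n : (total_balls u n)%:R = sigma%:R * (t + n%:R) :> R.
Proof. by rewrite /total_balls natrD natrM; field; exact: lt0r_neq0. Qed.

Let y0 n : 0 < t + n%:R.
Proof. by rewrite ltr_pwDl. Qed.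

Lemma g_factor n : (total_balls u n)%:R / ((total_balls u n)%:R + m%:R * delta) =
  (t + n%:R) / (t + L + n%:R).
Proof.
rewrite totalE mdelta addrAC -mulrDr invfM mulrACA divff ?mul1r//.
exact: lt0r_neq0.
Qed.

Lemma g_prod n : g u R n = \prod_(j < n) ((t + j%:R) / (t + L + j%:R)).
Proof. by apply: eq_bigr => j _; rewrite g_factor. Qed.

Lemma gS n : g u R n.+1 = g u R n * ((t + n%:R) / (t + L + n%:R)).
Proof. by rewrite !g_prod big_ord_recr. Qed.

Lemma g_gt0 n : 0 < g u R n.
Proof.
by rewrite g_prod prodr_gt0// => j _; rewrite divr_gt0// addrAC addr_gt0.
Qed.

Lemma g_le1 n : g u R n <= 1.
Proof.
elim: n => [|n IH]; first by rewrite g_prod big_ord0.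
have yL : 0 < t + L + n%:R by rewrite addrAC addr_gt0.
rewrite gS; apply: mulr_ile1 => //; first exact: ltW (g_gt0 n).
  by rewrite divr_ge0// ltW.
by rewrite ler_pdivrMr// mul1r addrAC lerDl ltW.
Qed.

Lemma added_white k : (k <= m)%N -> (a (m - k))%:~R = delta * k%:R + (a m)%:~R :> R.
Proof.
move=> km; case: hu => _ [_ aff _].
by rewrite (aff _ (leq_subr k m)) subKn// rmorphD rmorphM/= mulrC.
Qed.

(** The drift terms cancel because T_n = sigma (t + n), m delta = sigma L and
    c (1 - L) = a_m. *)
Lemma scaledS n x k : (k <= m)%N ->
  scaled n.+1 (x + a (m - k)) =
  scaled n x + g u R n.+1 * delta * (k%:R - m%:R * x%:~R / (total_balls u n)%:R).
Proof.
move=> km; rewrite /scaled intrD added_white// -cL -natr1 totalE.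
have yL : 0 < t + n%:R + L by rewrite addr_gt0.
have gE : g u R n = g u R n.+1 * ((t + n%:R + L) / (t + n%:R)).
  rewrite gS (addrAC t L); move: (lt0r_neq0 (y0 n)) (lt0r_neq0 yL).
  move: (t + n%:R) => y yn0 yLn0.
  by field; rewrite yn0.
have De : delta * (m%:R * x%:~R / (sigma%:R * (t + n%:R))) = L * x%:~R / (t + n%:R).
  rewrite !mulrA [delta * _]mulrC mdelta.
  move: (lt0r_neq0 (y0 n)); move: (t + n%:R) => y yn0.
  move: (lt0r_neq0 sigma0); move: sigma%:R => s sn0.
  by field; rewrite yn0.
rewrite -[_ * delta * _]mulrA [delta * (k%:R - _)]mulrBr De gE.
rewrite -[_ * _ * (x%:~R - _)]mulrA -mulrDr.
congr (_ * _).
have -> : t + (n%:R + 1) = t + n%:R + 1 by rewrite addrA.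
move: (lt0r_neq0 (y0 n)); move: (t + n%:R) => y yn0.
by field.
Qed.

Lemma stateS n w : state u K n.+1 w = state u K n w + a (m - K n w).
Proof. by rewrite /state /white big_ord_recr/= addrA. Qed.

Definition jump n (x : int) (k : nat) : R :=
  g u R n.+1 * delta * (k%:R - m%:R * x%:~R / (total_balls u n)%:R).

Lemma mean_ball_bounds n (x : int) : 0 <= x -> x <= (total_balls u n)%:Z ->
  0 <= m%:R * x%:~R / (total_balls u n)%:R :> R /\
  m%:R * x%:~R / (total_balls u n)%:R <= m%:R :> R.
Proof.
move=> x0 xT; have T0 : 0 < (total_balls u n)%:R :> R by rewrite ltr0n (total_balls_gt0 hu).
split; first by rewrite divr_ge0 ?mulr_ge0 ?ler0z// ltW.
rewrite ler_pdivrMr// ler_pM2l//.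
by rewrite -[(total_balls u n)%:R]/((total_balls u n)%:Z%:~R) ler_int.
Qed.

Section Jumps.
Variables (n : nat) (x : int).
Hypotheses (x0 : 0 <= x) (xT : x <= (total_balls u n)%:Z).
Local Notation mean := (m%:R * x%:~R / (total_balls u n)%:R : R).
Local Notation tr := (transition u M n x : nat -> R).

Let mean0 : 0 <= mean.
Proof. by have [] := mean_ball_bounds x0 xT. Qed.

Let mean_le : mean <= m%:R.
Proof. by have [] := mean_ball_bounds x0 xT. Qed.

Let sumq : \sum_(k < m.+1) tr k = 1.
Proof. exact: sum_transition. Qed.

Let sumqk : \sum_(k < m.+1) tr k * k%:R = mean.
Proof. exact: mean_transition. Qed.

Lemma norm_jump k : (k <= m)%N -> `|jump n x k| <= delta * m%:R.
Proof.
move=> km; rewrite /jump !normrM (gtr0_norm (g_gt0 _)) (gtr0_norm delta0) -mulrA.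
rewrite -[leRHS]mul1r; apply: ler_pM.
- exact: ltW (g_gt0 _).
- by rewrite mulr_ge0// ltW.
- exact: g_le1.
rewrite ler_pM2l// ler_norml.
have : k%:R <= m%:R :> R by rewrite ler_nat.
have : 0 <= k%:R :> R by [].
move: mean0 mean_le; move: (mean) => z; lra.
Qed.

Lemma mean_jump : \sum_(k < m.+1) tr k * jump n x k = 0.
Proof.
rewrite /jump; under eq_bigr do rewrite mulrCA mulrBr.
rewrite -big_distrr/= sumrB sumqk -big_distrl/= sumq mul1r subrr mulr0.
by [].
Qed.

(** As the count is at most m, its second moment is at most m times its mean. *)
Lemma variance_jump_le : \sum_(k < m.+1) tr k * jump n x k ^+ 2 <=
  (g u R n.+1 * delta) ^+ 2 * m%:R * mean.
Proof.
rewrite -mulrA.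
have e : \sum_(k < m.+1) tr k * (m%:R * k%:R - 2 * mean * k%:R + mean ^+ 2) <= m%:R * mean.
  have -> : \sum_(k < m.+1) tr k * (m%:R * k%:R - 2 * mean * k%:R + mean ^+ 2) =
    \sum_(k < m.+1) ((m%:R - 2 * mean) * (tr k * k%:R) + tr k * mean ^+ 2).
    by apply: eq_bigr => k _; ring.
  rewrite big_split/= -big_distrr -big_distrl/= sumqk sumq.
  by have := sqr_ge0 mean; lra.
apply: le_trans (ler_wpM2l (sqr_ge0 (g u R n.+1 * delta)) e).
rewrite big_distrr/=; apply: ler_sum => k _.
rewrite [leRHS]mulrCA ler_wpM2l ?transition_ge0// /jump exprMn ler_wpM2l ?sqr_ge0//.
have : k%:R <= m%:R :> R by rewrite ler_nat -ltnS.
have : 0 <= k%:R :> R by [].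
move: (mean) => z; nra.
Qed.

End Jumps.

Section Potential.
Variable v : nat -> R.
Hypothesis v0 : forall n, 0 <= v n.
Hypothesis variance_v : forall n x, 0 <= x -> x <= (total_balls u n)%:Z ->
  \sum_(k < m.+1) transition u M n x k * jump n x k ^+ 2 <=
  (v n - v n.+1) * (1 + `|scaled n x|).

(** The first-order term of the expansion averages to zero, and the second-order one
    is controlled by the variance bound. *)
Lemma scaled_moment_step q r : q.+1 = r.*2 -> exists2 C : R, 0 <= C & forall n,
  \int[P]_w (1 + scaled n.+1 (state u K n.+1 w) ^+ r.*2) <=
  (1 + C * (v n - v n.+1)) * \int[P]_w (1 + scaled n (state u K n w) ^+ r.*2).
Proof.
move=> qr.
have c00 : 0 <= delta * m%:R by rewrite mulr_ge0// ltW.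
have [C C0 stepC] := power_step q c00.
exists (C * 2 ^+ r.*2) => [|n]; first by rewrite mulr_ge0.
have [Km _] := hK.
pose F x k := 1 + (scaled n x + jump n x k) ^+ r.*2.
have -> : \int[P]_w (1 + scaled n.+1 (state u K n.+1 w) ^+ r.*2) =
    \int[P]_w F (state u K n w) (K n w).
  by apply: eq_Rintegral => w _; rewrite stateS scaledS.
rewrite (expectation_draw hu hK).
rewrite -RintegralZl//; last exact: (integrable_state hK n (fun x => 1 + scaled n x ^+ r.*2)).
apply: (expectation_state_le hu hK (f := fun x => \sum_(k < m.+1) transition u M n x k * F x k)
  (g := fun x => (1 + C * 2 ^+ r.*2 * (v n - v n.+1)) * (1 + scaled n x ^+ r.*2))) => x x0 xT.
set z := scaled n x.
have var := variance_v x0 xT; rewrite -/z in var.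
have z1 : 0 < 1 + `|z| by rewrite ltr_pwDl.
have vS : 0 <= v n - v n.+1.
  rewrite -(pmulr_lge0 _ z1); apply: le_trans var.
  by apply: sumr_ge0 => k _; rewrite mulr_ge0 ?transition_ge0 ?sqr_ge0.
apply: (@le_trans _ _ (\sum_(k < m.+1) (transition u M n x k * (1 + z ^+ r.*2) +
    (q.+1%:R * z ^+ q) * (transition u M n x k * jump n x k) +
    (C * (1 + `|z|) ^+ q) * (transition u M n x k * jump n x k ^+ 2)))).
  apply: ler_sum => k _; rewrite /F -/z -qr.
  have := stepC z (jump n x k) (norm_jump x0 xT (ltn_ord k)).
  move=> /(le_trans (ler_norm _)) h.
  have -> : transition u M n x k * (1 + z ^+ q.+1) +
    (q.+1%:R * z ^+ q) * (transition u M n x k * jump n x k) +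
    (C * (1 + `|z|) ^+ q) * (transition u M n x k * jump n x k ^+ 2) =
    transition u M n x k * (1 + (z ^+ q.+1 + q.+1%:R * z ^+ q * jump n x k +
    C * jump n x k ^+ 2 * (1 + `|z|) ^+ q)) by ring.
  rewrite ler_wpM2l ?transition_ge0// lerD2l; lra.
rewrite !big_split/= -!big_distrr -big_distrl/= (sum_transition hu x0 xT) (mean_jump x0 xT).
rewrite mulr0 addr0 mul1r mulrDl mul1r lerD2l.
apply: le_trans (ler_wpM2l _ var) _; first by rewrite mulr_ge0// exprn_ge0// ltW.
have -> : C * (1 + `|z|) ^+ q * ((v n - v n.+1) * (1 + `|z|)) =
  C * (v n - v n.+1) * (1 + `|z|) ^+ q.+1 by rewrite exprS; ring.
rewrite qr.
apply: le_trans (ler_wpM2l _ (power_weight z r)) _; first by rewrite mulr_ge0.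
by rewrite le_eqVlt; apply/orP; left; apply/eqP; ring.
Qed.

Lemma scaled_moments_bounded r : exists C : R, forall n,
  \int[P]_w (scaled n (state u K n w) ^+ r.*2) <= C.
Proof.
have int1 n s : P.-integrable setT (EFin \o (fun w => 1 + scaled n (state u K n w) ^+ s)).
  exact: (integrable_state hK n (fun x => 1 + scaled n x ^+ s)).
have int2 n s : P.-integrable setT (EFin \o (fun w => scaled n (state u K n w) ^+ s)).
  exact: (integrable_state hK n (fun x => scaled n x ^+ s)).
case: r => [|r].
  exists 1 => n; under eq_Rintegral do rewrite expr0.
  by rewrite expectation_constant.
have [C C0 step] := @scaled_moment_step r.*2.+1 r.+1 erefl.
set A := fun n => \int[P]_w (1 + scaled n (state u K n w) ^+ r.+1.*2).
have A0 n : 0 <= A n.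
  apply: Rintegral_ge0 => w _.
  by rewrite addr_ge0// -mul2n exprM exprn_ge0// sqr_ge0.
exists (A 0 * expR (C * v 0)) => n.
apply: (@le_trans _ _ (A n)).
  by apply: le_Rintegral => // w _; rewrite lerDr.
have An : A n <= A 0 * expR (C * (v 0 - v n)).
  elim: n => [|n IH]; first by rewrite subrr mulr0 expR0 mulr1.
  apply: le_trans (step n) _.
  apply: le_trans (ler_wpM2r (A0 n) (expR_ge1Dx _)) _.
  apply: le_trans (ler_wpM2l (expR_ge0 _) IH) _.
  rewrite mulrCA -expRD le_eqVlt; apply/orP; left; apply/eqP.
  by congr (_ * expR _); ring.
apply: le_trans An _; rewrite ler_wpM2l// ler_expR ler_wpM2l// gerBl.
exact: v0.
Qed.

End Potential.

(** Here only the crude bound m^2 on the variance of the count is used.  With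
    y = t + n, the decrement of (t + n) g_n^2 is
    g_{n+1}^2 ((2 L - 1) y + L^2) / y >= (2 L - 1) g_{n+1}^2. *)
Lemma variance_large : 1 / 2 < L ->
  let v n := (delta * m%:R) ^+ 2 / (2 * L - 1) * ((t + n%:R) * g u R n ^+ 2) in
  (forall n, 0 <= v n) /\
  forall n x, 0 <= x -> x <= (total_balls u n)%:Z ->
  \sum_(k < m.+1) transition u M n x k * jump n x k ^+ 2 <=
  (v n - v n.+1) * (1 + `|scaled n x|).
Proof.
move=> L12 v; have L1 : 0 < 2 * L - 1 by lra.
split=> [n|n x x0 xT].
  by apply: mulr_ge0; [apply: divr_ge0|apply: mulr_ge0];
    rewrite ?sqr_ge0 ?(ltW L1) ?(ltW (y0 n)).
apply: le_trans (variance_jump_le x0 xT) _.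
have [mu0 mum] := mean_ball_bounds x0 xT.
have vd : (g u R n.+1 * delta * m%:R) ^+ 2 <= v n - v n.+1.
  have yL : 0 < t + n%:R + L by rewrite addr_gt0.
  have gE : g u R n = g u R n.+1 * ((t + n%:R + L) / (t + n%:R)).
    rewrite gS (addrAC t L); move: (lt0r_neq0 (y0 n)) (lt0r_neq0 yL).
    move: (t + n%:R) => y yn0 yLn0.
    by field; rewrite yn0.
  have -> : v n.+1 = (delta * m%:R) ^+ 2 / (2 * L - 1) * ((t + n%:R + 1) * g u R n.+1 ^+ 2).
    by rewrite /v -[n.+1%:R]natr1 addrA.
  rewrite /v gE; move: (y0 n); move: (t + n%:R) => y yp.
  move: (g _ _ _) (m%:R) => g' mm.
  rewrite -subr_ge0.
  have -> : (delta * mm) ^+ 2 / (2 * L - 1) * (y * (g' * ((y + L) / y)) ^+ 2) -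
    (delta * mm) ^+ 2 / (2 * L - 1) * ((y + 1) * g' ^+ 2) - (g' * delta * mm) ^+ 2 =
    (delta * mm) ^+ 2 * g' ^+ 2 * L ^+ 2 / (y * (2 * L - 1)).
    by field; rewrite !lt0r_neq0.
  by apply: divr_ge0; apply: mulr_ge0; rewrite ?sqr_ge0 ?(ltW yp) ?(ltW L1)// mulr_ge0 ?sqr_ge0.
apply: (@le_trans _ _ ((g u R n.+1 * delta * m%:R) ^+ 2)).
  rewrite [leRHS]exprMn -mulrA ler_wpM2l ?sqr_ge0// expr2.
  by rewrite ler_pM2l.
apply: (le_trans vd); rewrite ler_peMr ?lerDl//.
by apply: (le_trans _ vd); exact: sqr_ge0.
Qed.

(** The decrement of g_n is g_{n+1} m delta / T_n, and when c = 0 the mean count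
    m W_n / T_n is a multiple of the martingale itself. *)
Lemma variance_triangular : c = 0 ->
  let v n := m%:R * delta * g u R n in
  (forall n, 0 <= v n) /\
  forall n x, 0 <= x -> x <= (total_balls u n)%:Z ->
  \sum_(k < m.+1) transition u M n x k * jump n x k ^+ 2 <=
  (v n - v n.+1) * (1 + `|scaled n x|).
Proof.
move=> c0 v.
split=> [n|n x x0 xT]; first by rewrite !mulr_ge0 ?(ltW delta0) ?(ltW (g_gt0 n)).
apply: le_trans (variance_jump_le x0 xT) _.
have T0 : 0 < (total_balls u n)%:R :> R by rewrite ltr0n (total_balls_gt0 hu).
have gd : g u R n - g u R n.+1 = g u R n.+1 * (m%:R * delta / (total_balls u n)%:R).
  have yL : 0 < t + n%:R + L by rewrite addr_gt0.
  rewrite gS mdelta totalE (addrAC t L).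
  move: (lt0r_neq0 (y0 n)) (lt0r_neq0 yL); move: (t + n%:R) => y yn0 yLn0.
  move: (lt0r_neq0 sigma0); move: sigma%:R => s sn0.
  by field; rewrite sn0 yn0.
have g01 : g u R n.+1 <= g u R n.
  by rewrite -subr_ge0 gd mulr_ge0 ?divr_ge0 ?mulr_ge0 ?(ltW delta0) ?(ltW (g_gt0 n.+1)).
have gn := g_gt0 n; have gn1 := g_gt0 n.+1.
have xR : 0 <= x%:~R :> R by rewrite ler0z.
rewrite /v -mulrBr gd /scaled c0 mul0r subr0 ger0_norm; last by rewrite mulr_ge0// ltW.
set w := m%:R * delta / (total_balls u n)%:R.
have w0 : 0 <= w by rewrite divr_ge0 ?mulr_ge0 ?(ltW delta0).
have -> : (g u R n.+1 * delta) ^+ 2 * m%:R * (m%:R * x%:~R / (total_balls u n)%:R) =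
   m%:R * delta * (g u R n.+1 * w) * (g u R n.+1 * x%:~R).
  by rewrite /w; field; rewrite lt0r_neq0.
rewrite ler_wpM2l//.
  by rewrite !mulr_ge0 ?(ltW delta0) ?(ltW gn1).
by apply: le_trans (ler_wpM2r xR g01) _; rewrite lerDr.
Qed.

Lemma mean_scaled n : \int[P]_w scaled n (state u K n w) = (white0 u)%:R - c * t.
Proof.
elim: n => [|n IH].
  under eq_Rintegral do rewrite /scaled /g big_ord0 mul1r addr0 /state /white big_ord0 addr0.
  by rewrite expectation_constant.
have [Km _] := hK; rewrite -IH.
have -> : \int[P]_w scaled n.+1 (state u K n.+1 w) =
    \int[P]_w (fun x k => scaled n x + jump n x k) (state u K n w) (K n w).
  by apply: eq_Rintegral => w _; rewrite stateS scaledS.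
rewrite (expectation_draw hu hK n (fun x k => scaled n x + jump n x k)) /=.
have E x : 0 <= x -> x <= (total_balls u n)%:Z ->
    \sum_(k < m.+1) transition u M n x k * (scaled n x + jump n x k) = scaled n x.
  move=> x0 xT; under eq_bigr do rewrite mulrDr.
  by rewrite big_split/= -big_distrl/= (sum_transition hu x0 xT) (mean_jump x0 xT) mul1r addr0.
apply/eqP; rewrite eq_le; apply/andP; split.
  by apply: (expectation_state_le hu hK (f := fun x => \sum_(k < m.+1)
    transition u M n x k * (scaled n x + jump n x k)) (g := scaled n)) => x x0 xT; rewrite E.
by apply: (expectation_state_le hu hK (g := fun x => \sum_(k < m.+1)
    transition u M n x k * (scaled n x + jump n x k)) (f := scaled n)) => x x0 xT; rewrite E.
Qed.

Lemma centered_martingaleE n w :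
  centered_martingale u K n w = scaled n (state u K n w) - ((white0 u)%:R - c * t).
Proof.
have gn := g_gt0 n.
have EW : fine 'E_P[W u K n] = c * (t + n%:R) + (g u R n)^-1 * ((white0 u)%:R - c * t).
  rewrite -(mean_scaled n) unlock -/(Rintegral P setT (W u K n)).
  have iS := integrable_state hK n (scaled n).
  rewrite -RintegralZl//.
  have i1 := finite_measure_integrable_cst P (c * (t + n%:R)) (@measurableT _ T).
  rewrite -[X in _ = X + _](expectation_constant P).
  rewrite -RintegralD//; last exact: (integrableZl measurableT _ iS).
  apply: eq_Rintegral => w' _; rewrite /scaled mulrA mulVf ?gt_eqF// mul1r.
  by rewrite addrC subrK.
rewrite /centered_martingale EW /scaled -/(state u K n w) /W -/(state u K n w).
by field; rewrite (lt0r_neq0 sigma0) lt0r_neq0.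
Qed.

(** * Moments of the limit *)

Section Limit.
Hypothesis L1 : L <= 1.
Hypothesis moments : forall r, exists C : R, forall n,
  \int[P]_w (scaled n (state u K n w) ^+ r.*2) <= C.
Variable Y : T -> R.
Hypothesis mY : measurable_fun setT Y.
Hypothesis cvgY : {ae P, forall w, scaled n (state u K n w) @[n --> \oo] --> Y w}.
Local Notation rho := (Gamma (t + L) / Gamma t).

Lemma cvg_g_rho : n%:R `^ L * g u R n @[n --> \oo] --> rho.
Proof. by under eq_fun do rewrite g_prod; apply: cvg_prod_Gamma => //; exact: ltW. Qed.

(** By [cvg_g_rho], g_n is equivalent to rho n^(-L). *)
Lemma cvg_g0 : g u R n @[n --> \oo] --> (0 : R).
Proof.
have powL : (n%:R `^ L)^-1 @[n --> \oo] --> (0 : R).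
  apply/gtr0_cvgV0.
    by near=> n; rewrite powR_gt0// ltr0n; near: n; exact: nbhs_infty_gt.
  apply/cvgryPge => A; near=> n.
  have An : (`|A| `^ L^-1) <= n%:R by near: n; exact: nbhs_infty_ger.
  apply: le_trans (ler_norm A) _.
  have e : `|A| = (`|A| `^ L^-1) `^ L by rewrite -powRrM mulVf ?powRr1// lt0r_neq0.
  rewrite [leLHS]e ge0_ler_powR ?nnegrE ?powR_ge0 ?(ltW L0)//.
have h : (n%:R `^ L)^-1 * (n%:R `^ L * g u R n) @[n --> \oo] --> (0 : R).
  by rewrite -(mul0r rho); apply: cvgM powL cvg_g_rho.
apply: cvg_trans h.
apply: near_eq_cvg; near=> n => /=.
rewrite mulrA mulVf ?mul1r// gt_eqF// powR_gt0// ltr0n; near: n; exact: nbhs_infty_gt.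
Unshelve. all: end_near. Qed.

(** The normalised variables of the limit moment are (M_n + c t g_n)^s divided by
    (n^L g_n)^s; the numerators have bounded second moments, so their means
    converge, and the denominators converge to rho^s. *)
Lemma limit_moments s :
  P.-integrable setT (EFin \o (fun w => Y w ^+ s)) /\
  \int[P]_w (Y w ^+ s) = rho ^+ s * limit_moment u K s.
Proof.
case: s => [|s].
  split; first exact: finite_measure_integrable_cst.
  by under eq_Rintegral do rewrite expr0; rewrite expectation_constant expr0 mul1r.
pose Q n (x : int) : R := (scaled n x + g u R n * (c * t)) ^+ s.+1.
have cQ : {ae P, forall w, Q n (state u K n w) @[n --> \oo] --> Y w ^+ s.+1}.
  apply: filterS cvgY => w cw.
  apply: (@continuous_cvg _ _ _ _ _ (fun n => scaled n (state u K n w) + g u R n * (c * t))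
    (fun z : R => z ^+ s.+1)); first exact: exprn_continuous.
  rewrite -[Y w]addr0 -(mul0r (c * t)).
  by apply: cvgD => //; apply: cvgM; [exact: cvg_g0|exact: cvg_cst].
have [C CP] := moments s.+1.
pose B := `|c * t|.
have B0 : 0 <= B by exact: normr_ge0.
pose C' := (1 + B) ^+ s.+1.*2 * (2 ^+ s.+1.*2 * (1 + C)).
have Q2 n : (\int[P]_w (Q n (state u K n w) ^+ 2)%:E <= C'%:E)%E.
  have iQ := integrable_state hK n (fun x => Q n x ^+ 2).
  have iS := integrable_state hK n (fun x => scaled n x ^+ s.+1.*2).
  rewrite -[leLHS]fineK; last exact: integrable_fin_num iQ.
  rewrite lee_fin -/(Rintegral P setT (fun w => Q n (state u K n w) ^+ 2)).
  pose q := (1 + B) ^+ s.+1.*2 * 2 ^+ s.+1.*2.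
  have q0 : 0 <= q by rewrite mulr_ge0// exprn_ge0// addr_ge0.
  have i1 := finite_measure_integrable_cst P 1 (@measurableT _ T).
  have iB := integrable_state hK n (fun x => 1 + scaled n x ^+ s.+1.*2).
  apply: (@le_trans _ _ (\int[P]_w (q * (1 + scaled n (state u K n w) ^+ s.+1.*2)))).
    apply: le_Rintegral => //; first exact: (integrableZl measurableT _ iB).
    move=> w _; rewrite /Q -exprM muln2; move: (scaled n _) => z.
    have evenX (e : R) : e ^+ s.+1.*2 = `|e| ^+ s.+1.*2.
      by rewrite -normrX ger0_norm// -mul2n exprM exprn_ge0// sqr_ge0.
    rewrite [leLHS]evenX /q -[leRHS]mulrA.
    apply: le_trans (ler_wpM2l _ (power_weight z s.+1)); last first.
      by rewrite exprn_ge0// addr_ge0.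
    rewrite -exprMn lerXn2r ?nnegrE ?mulr_ge0 ?addr_ge0//.
    have gB : `|g u R n * (c * t)| <= B.
      rewrite normrM ler_piMl// ger0_norm ?g_le1//; exact: ltW (g_gt0 n).
    have := ler_normD z (g u R n * (c * t)).
    have := normr_ge0 z; move: B0.
    by move: gB; move: (`|z|) (`|g u R n * (c * t)|) (`|z + g u R n * (c * t)|) (B) => *; nra.
  rewrite RintegralZl// RintegralD// expectation_constant /C' -/q mulrA.
  by rewrite ler_wpM2l// lerD2l.
have [] := cvg_expectation_sqr_bounded (C := C') _ _ cQ Q2.
- by move=> n; exact: (measurable_state hK n (Q n)).
- exact: measurable_funX.
move=> iY limQ; split => //.
have rho0 : 0 < rho by rewrite divr_gt0 ?Gamma_gt0// addr_gt0.
suff -> : limit_moment u K s.+1 = (\int[P]_w (Y w ^+ s.+1)) / rho ^+ s.+1.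
  by rewrite mulrC divfK// expf_neq0// lt0r_neq0.
rewrite /limit_moment; apply/cvg_lim => //.
have E n : fine 'E_P[(fun w => (Wtilde u K n w ^+ s.+1 / n%:R `^ (s.+1%:R * L))%R)] =
    (\int[P]_w Q n (state u K n w)) / (n%:R `^ L * g u R n) ^+ s.+1.
  rewrite unlock -RintegralZr//; last exact: (integrable_state hK n (Q n)).
  apply: eq_Rintegral => w _.
  have -> : n%:R `^ (s.+1%:R * L) = (n%:R `^ L) ^+ s.+1.
    by rewrite mulrC powRrM powR_mulrn ?powR_ge0.
  rewrite /Q /scaled -mulrDr.
  have -> : (state u K n w)%:~R - c * (t + n%:R) + c * t = Wtilde u K n w.
    by rewrite /Wtilde /W -/(state u K n w); ring.
  rewrite [_ `^ _ * g u R n]mulrC !exprMn invfM mulrACA divff ?mul1r//.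
  by rewrite expf_neq0// lt0r_neq0// g_gt0.
under eq_fun do rewrite E.
apply: cvgM => //; apply: cvgV; first by rewrite expf_neq0// lt0r_neq0.
apply: (@continuous_cvg _ _ _ _ _ (fun n => n%:R `^ L * g u R n)
    (fun z : R => z ^+ s.+1)); first exact: exprn_continuous.
exact: cvg_g_rho.
Qed.

End Limit.

End UrnMoments.

Lemma expectation_Rintegral {R : realType} {d : measure_display} {T : measurableType d}
  (P : probability T R) (f : T -> R) : P.-integrable setT (EFin \o f) ->
  'E_P[f]%E = (\int[P]_w f w)%:E.
Proof. by move=> i; rewrite unlock fineK//; exact: integrable_fin_num. Qed.

Lemma moment_binomial {R : realType} {d : measure_display} {T : measurableType d}
  (P : probability T R) (Y : T -> R) (b : R) s :
  (forall k, P.-integrable setT (EFin \o (fun w => Y w ^+ k))) ->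
  P.-integrable setT (EFin \o (fun w => (b + Y w) ^+ s)) /\
  \int[P]_w (b + Y w) ^+ s = \sum_(k < s.+1) 'C(s, k)%:R * (\int[P]_w Y w ^+ k) * b ^+ (s - k).
Proof.
move=> iY.
pose F (k : 'I_s.+1) w := (('C(s, k)%:R * b ^+ (s - k)) * Y w ^+ k)%:E.
have iF k : P.-integrable setT (F k) by exact: (integrableZl measurableT _ (iY k)).
have e : (fun w => ((b + Y w) ^+ s)%:E) = (fun w => \sum_k F k w)%E.
  apply/funext => w; rewrite sumEFin exprDn; congr EFin; apply: eq_bigr => k _.
  by rewrite -mulr_natl mulrA.
split.
  by rewrite [X in P.-integrable _ X]e; exact: integrable_sum.
rewrite /Rintegral e integral_sum// -[RHS]/(fine (_)%:E) -sumEFin; congr fine.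
apply: eq_bigr => k _.
rewrite /F; under eq_integral do rewrite EFinM.
rewrite (integralZl measurableT (iY k)).
rewrite -[in LHS](fineK (integrable_fin_num measurableT (iY k))) -EFinM.
by congr EFin; rewrite /Rintegral mulrAC.
Qed.

Theorem proposition2 (R : realType) (u : urn) (M : sampling)
    (d : measure_display) (T : measurableType d) (P : probability T R)
    (K : nat -> {RV P >-> nat})
    (hu : urn_assumptions u M) (hK : urn_process u K M) :
  (large_index u R ->
   forall Winf : {RV P >-> R},
     {ae P, forall w, centered_martingale u K n w @[n --> \oo] --> Winf w} ->
   forall s : nat, (1 <= s)%N ->
     P.-integrable [set: T] (fun w => ((Winf w ^+ s)%R)%:E) /\
     'E_P[(fun w => (Winf w ^+ s)%R)]%E =
      (\sum_(k < s.+1)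
         'C(s, k)%:R *
         (Gamma ((total0 u)%:R / (balance u)%:R + Lambda u R) ^+ k /
          Gamma ((total0 u)%:R / (balance u)%:R : R) ^+ k) *
         limit_moment u K k *
         ((whiteadd u (ssize u))%:~R * (total0 u)%:R /
            ((balance u)%:R * (1 - Lambda u R)) - (white0 u)%:R) ^+ (s - k))%:E)
  /\
  (triangular u ->
   forall Winf : {RV P >-> R},
     {ae P, forall w, triangular_martingale u K n w @[n --> \oo] --> Winf w} ->
   forall s : nat, (1 <= s)%N ->
     P.-integrable [set: T] (fun w => ((Winf w ^+ s)%R)%:E) /\
     'E_P[(fun w => (Winf w ^+ s)%R)]%E =
      (Gamma ((total0 u)%:R / (balance u)%:R + Lambda u R) ^+ s /
       Gamma ((total0 u)%:R / (balance u)%:R : R) ^+ s *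
       limit_moment u K s)%:E).
Proof.
have sigma0 : 0 < (balance u)%:R :> R by case: hu => -[_ s1 _] _; rewrite ltr0n.
have m0 : 0 < (ssize u)%:R :> R by case: hu => -[m1 _ _] _; rewrite ltr0n.
pose t : R := (total0 u)%:R / (balance u)%:R.
split=> [[_ /andP[L12 L1]] Winf cW s _|[am0 a0 ma] Winf cW s _].
- have L0 : 0 < Lambda u R by apply: lt_trans L12; rewrite divr_gt0.
  have cL : drift u R * (1 - Lambda u R) = (whiteadd u (ssize u))%:~R.
    by rewrite /drift divfK// subr_eq0 gt_eqF.
  have [v0 var] := variance_large hu L0 L12.
  have mom := scaled_moments_bounded hu hK L0 cL v0 var.
  pose b := drift u R * t - (white0 u)%:R.
  pose Y w := Winf w - b.
  have mY : measurable_fun setT Y by exact: measurable_funB.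
  have cY : {ae P, forall w, scaled u n (state u K n w) @[n --> \oo] --> Y w}.
    apply: filterS cW => w cw.
    have -> : (fun n => scaled u n (state u K n w)) =
        (fun n => centered_martingale u K n w - b).
      by apply/funext => n; rewrite (centered_martingaleE hu hK L0 cL) /b /t; ring.
    by apply: cvgB => //; exact: cvg_cst.
  have lim k := limit_moments hu hK L0 (ltW L1) mom mY cY k.
  have [iW eW] := moment_binomial b s (fun k => (lim k).1).
  have We w : b + Y w = Winf w by rewrite /Y addrC subrK.
  have We' : (fun w => (b + Y w) ^+ s) = (fun w => Winf w ^+ s).
    by apply/funext => w; rewrite We.
  rewrite We' in iW eW; split; first exact: iW.
  rewrite expectation_Rintegral// eW; congr EFin; apply: eq_bigr => k _.
  rewrite (lim k).2 expr_div_n; congr (_ * _ ^+ _); first by rewrite !mulrA.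
  rewrite /b /drift /t; congr (_ - _); field.
  by rewrite (lt0r_neq0 sigma0) subr_eq0 gt_eqF.
- have L0 : 0 < Lambda u R.
    by rewrite /Lambda am0 subr0 mulr_gt0 ?divr_gt0// ltr0z.
  have L1 : Lambda u R <= 1.
    rewrite /Lambda am0 subr0 mulrAC ler_pdivrMr// mul1r.
    by move: ma; rewrite -(ler_int R) intrM.
  have c0 : drift u R = 0 by rewrite /drift am0 mul0r.
  have cL : drift u R * (1 - Lambda u R) = (whiteadd u (ssize u))%:~R.
    by rewrite c0 am0 mul0r.
  have [v0 var] := variance_triangular hu L0 c0.
  have mom := scaled_moments_bounded hu hK L0 cL v0 var.
  have cY : {ae P, forall w, scaled u n (state u K n w) @[n --> \oo] --> Winf w}.
    apply: filterS cW => w.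
    suff -> : triangular_martingale u K ^~ w = (fun n => scaled u n (state u K n w)) by [].
    by apply/funext => n; rewrite /scaled c0 mul0r subr0.
  have [iW eW] := limit_moments hu hK L0 L1 mom (measurable_funP Winf) cY s.
  split; first exact: iW.
  by rewrite expectation_Rintegral// eW expr_div_n.
Qed.
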